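(* Let $\Lambda$ be a left and right Noetherian ring which is $\infty$-Gorenstein. Then $\mathrm{fin.dim}\,\Lambda=\mathrm{Fin.dim}\,\Lambda=\mathrm{id}_\Lambda\Lambda$, where $\mathrm{id}_\Lambda\Lambda$ is the injective dimension of $\Lambda$ as a left $\Lambda$-module (these values may be infinite).
   Context: Let $0\to{}_\Lambda\Lambda\to I'_0\to I'_1\to\cdots$ be a minimal injective resolution of $\Lambda$ as a left module. $\Lambda$ is $\infty$-Gorenstein if the flat dimension of $I'_i$ is at most $i$ for all $i\ge0$. $\mathrm{Fin.dim}\,\Lambda$ is the supremum of the projective dimensions of all left $\Lambda$-modules of finite projective dimension; $\mathrm{fin.dim}\,\Lambda$ is the supremum of the projective dimensions of all finitely generated left $\Lambda$-modules of finite projective dimension. *)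

(* Defs.v *)
From HB Require Import structures.
From mathcomp Require Import all_boot all_order all_algebra.
From mathcomp Require Import boolp.
From mathcomp Require Import freeg.

Set Implicit Arguments.
Unset Strict Implicit.
Unset Printing Implicit Defensive.

Import GRing.Theory.
Local Open Scope ring_scope.
Local Open Scope quotient_scope.

(* Left modules over L are [lmodType L]; right modules over L are             *)
(* [lmodType L^c], where L^c is the opposite ring, so that for a : A in a     *)
(* right module and r : L, the element a.r is written (r : L^c) *: a.         *)
(* The zero ring is allowed.                                                  *)

(* Dimensions live in option nat, with None standing for infinity.            *)
Definition least (P : nat -> Prop) : option nat :=
  if pselect (exists n, `[< P n >]) is left h then Some (ex_minn h) else None.

Definition dim_le (x : option nat) (n : nat) : Prop :=
  if x is Some k then (k <= n)%N else False.

(* Supremum in the natural numbers extended by infinity: the least natural    *)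
(* number bounding S, or infinity when S has no such bound.                   *)
Definition dim_sup (S : option nat -> Prop) : option nat :=
  least (fun n => forall x, S x -> dim_le x n).

(* The tensor product of a right and a left module: the free abelian group on *)
(* A * M modulo the subgroup generated by the usual relations.                *)
Section Tensor.
Variables (L : pzRingType) (A : lmodType L^c) (M : lmodType L).

Inductive tensor_rel : {freeg (A * M) / int} -> Prop :=
| tensor_rel0 : tensor_rel 0
| tensor_relB x y : tensor_rel x -> tensor_rel y -> tensor_rel (x - y)
| tensor_relDl a a' m :
    tensor_rel (<< (a + a', m) >> - << (a, m) >> - << (a', m) >>)
| tensor_relDr a m m' :
    tensor_rel (<< (a, m + m') >> - << (a, m) >> - << (a, m') >>)
| tensor_relZ a (r : L) m :
    tensor_rel (<< ((r : L^c) *: a, m) >> - << (a, r *: m) >>).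

Definition tensor_relb : {pred {freeg (A * M) / int}} :=
  fun x => `[< tensor_rel x >].

Lemma tensor_relb_zmod_closed : zmod_closed tensor_relb.
Proof.
split; first exact/asboolP/tensor_rel0.
by move=> x y /asboolP hx /asboolP hy; apply/asboolP/tensor_relB.
Qed.

HB.instance Definition _ :=
  GRing.isZmodClosed.Build {freeg (A * M) / int} tensor_relb
    tensor_relb_zmod_closed.

Definition tensor := Quotient.quot tensor_relb.

End Tensor.

(* The induced map f (x) M : A (x) M -> B (x) M; it does not depend on the    *)
(* representative used, by tensor_map_pi.                                     *)
Section TensorMap.
Variables (L : pzRingType) (A B : lmodType L^c) (M : lmodType L).
Variable f : {linear A -> B}.

Definition freeg_tensor_map : {freeg (A * M) / int} -> {freeg (B * M) / int} :=
  fglift (fun p : A * M => << (f p.1, p.2) >> : {freeg (B * M) / int}).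

Definition tensor_map (x : tensor A M) : tensor B M :=
  \pi_(tensor B M) (freeg_tensor_map (repr x)).

Lemma freeg_tensor_mapB : {morph freeg_tensor_map : x y / x - y}.
Proof. exact: lift_is_additive. Qed.

Lemma freeg_tensor_map_rel x : tensor_rel x -> tensor_rel (freeg_tensor_map x).
Proof.
have E (p : A * M) : freeg_tensor_map << p >> = << (f p.1, p.2) >>.
  by rewrite /freeg_tensor_map liftU scale1r.
elim=> [|y z _ hy _ hz|a a' m|a m m'|a r m].
- by rewrite -(subrr 0) freeg_tensor_mapB subrr; apply: tensor_rel0.
- by rewrite freeg_tensor_mapB; apply: tensor_relB.
- by rewrite !freeg_tensor_mapB !E /= linearD; apply: tensor_relDl.
- by rewrite !freeg_tensor_mapB !E /=; apply: tensor_relDr.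
- by rewrite freeg_tensor_mapB !E /= linearZ; apply: tensor_relZ.
Qed.

Lemma tensor_map_pi x :
  tensor_map (\pi_(tensor A M) x) = \pi_(tensor B M) (freeg_tensor_map x).
Proof.
have piE (C : lmodType L^c) (y z : {freeg (C * M) / int}) :
    \pi_(tensor C M) y = \pi_(tensor C M) z <-> tensor_rel (y - z).
  split=> [/eqP|h].
    by rewrite -Quotient.idealrBE => /asboolP.
  by apply/eqP; rewrite -Quotient.idealrBE; apply/asboolP.
rewrite /tensor_map; apply/piE.
rewrite -freeg_tensor_mapB; apply: freeg_tensor_map_rel.
by apply/piE; rewrite reprK.
Qed.

End TensorMap.

Section Modules.
Variable L : pzRingType.

Definition left_noetherian : Prop :=
  forall I : nat -> {pred L^o},
    (forall n, submod_closed (I n)) ->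
    (forall n, {subset I n <= I n.+1}) ->
    exists n, forall m, (n <= m)%N -> I m =i I n.

Definition finitely_generated (M : lmodType L) : Prop :=
  exists (n : nat) (g : 'I_n -> M),
    forall x, exists c : 'I_n -> L, x = \sum_(i < n) c i *: g i.

Definition projective_module (P : lmodType L) : Prop :=
  forall (U V : lmodType L) (p : {linear U -> V}) (f : {linear P -> V}),
    (forall v, exists u, p u = v) ->
    exists g : {linear P -> U}, forall x, p (g x) = f x.

Definition injective_module (E : lmodType L) : Prop :=
  forall (U V : lmodType L) (j : {linear U -> V}) (f : {linear U -> E}),
    injective j ->
    exists g : {linear V -> E}, forall x, g (j x) = f x.

Definition flat_module (M : lmodType L) : Prop :=
  forall (A B : lmodType L^c) (f : {linear A -> B}),
    injective f -> injective (@tensor_map L A B M f).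

Definition exact_at (U V W : lmodType L) (f : {linear U -> V})
    (g : {linear V -> W}) : Prop :=
  forall y, g y = 0 <-> exists x, f x = y.

(* Exactness of ... -> X 1 -> X 0 -> M -> 0 with every X i in the class C.    *)
Definition left_resolution (C : lmodType L -> Prop) (M : lmodType L)
    (X : nat -> lmodType L) (d : forall i, {linear X i.+1 -> X i})
    (e : {linear X 0%N -> M}) : Prop :=
  [/\ forall i, C (X i),
      forall x, exists y, e y = x,
      exact_at (d 0%N) e
    & forall i, exact_at (d i.+1) (d i)].

(* Exactness of 0 -> M -> X 0 -> X 1 -> ... with every X i injective.         *)
Definition injective_resolution (M : lmodType L) (X : nat -> lmodType L)
    (d : forall i, {linear X i -> X i.+1}) (e : {linear M -> X 0%N}) : Prop :=
  [/\ forall i, injective_module (X i),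
      injective e,
      exact_at e (d 0%N)
    & forall i, exact_at (d i) (d i.+1)].

Definition vanishes_above (X : nat -> lmodType L) (n : nat) : Prop :=
  forall i, (n < i)%N -> forall x : X i, x = 0.

Definition left_dim (C : lmodType L -> Prop) (M : lmodType L) : option nat :=
  least (fun n => exists X d e,
    @left_resolution C M X d e /\ vanishes_above X n).

Definition proj_dim : lmodType L -> option nat := left_dim projective_module.

Definition flat_dim : lmodType L -> option nat := left_dim flat_module.

Definition inj_dim (M : lmodType L) : option nat :=
  least (fun n => exists X d e,
    @injective_resolution M X d e /\ vanishes_above X n).

Definition essential (E : lmodType L) (K : E -> Prop) : Prop :=
  forall S : {pred E}, submod_closed S ->
    (forall x, x \in S -> K x -> x = 0) -> forall x, x \in S -> x = 0.

(* By exactness, ker (d 0) = M and ker (d i.+1) is the cokernel of the map    *)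
(* into X i, so minimality says that each X i is the injective envelope of    *)
(* the preceding cokernel.                                                    *)
Definition minimal_injective_resolution (M : lmodType L)
    (X : nat -> lmodType L) (d : forall i, {linear X i -> X i.+1})
    (e : {linear M -> X 0%N}) : Prop :=
  injective_resolution d e /\
  forall i, essential (fun x : X i => d i x = 0).

(* A minimal injective resolution exists and is unique up to isomorphism, so  *)
(* it makes no difference which one is taken.                                 *)
Definition infinity_gorenstein : Prop :=
  exists X d e,
    @minimal_injective_resolution (L^o : lmodType L) X d e /\
    forall i, dim_le (flat_dim (X i)) i.

Definition big_finitistic_dim : option nat :=
  dim_sup (fun x => exists M : lmodType L, proj_dim M = x /\ x <> None).

Definition little_finitistic_dim : option nat :=
  dim_sup (fun x => exists M : lmodType L,
    [/\ finitely_generated M, proj_dim M = x & x <> None]).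

End Modules.

(* Main.v *)
(* Write E^i = Ext^i(-, L).                                                   *)
(*                                                                            *)
(* fin.dim <= Fin.dim is clear.  Fin.dim <= id L (Bass): over a left          *)
(* noetherian ring a direct sum of copies of an injective resolution of L is  *)
(* again injective (Baer), so Ext^m(M, P) = 0 for P projective and m > id L;  *)
(* the first map of a projective resolution of length m > id L then splits.   *)
(*                                                                            *)
(* id L <= fin.dim: let I be the given minimal injective resolution and let   *)
(* m > 0 with I_m <> 0.  For 0 <> x in ker (I_m -> I_(m+1)), minimality makes *)
(* the inclusion of L x in I_m a nonzero class of E^m (L x).  Suppose we know *)
(*   (G) E^i (E^m M) = 0 for M finitely generated on the left and i < m.      *)
(* Then dualizing a resolution of the right module E^m (L x) gives a finitely *)
(* generated left module of finite projective dimension at least m.           *)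
(*                                                                            *)
(* The hypothesis fd I_i <= i yields at once the mirror image of (G), for     *)
(* submodules as well: if Y is contained in E^j X with X a finitely generated *)
(* right module, and i < j, then Hom(Y, I_i) = 0, because Hom(E^j X, I_i) is  *)
(* Tor_j(X, I_i); hence E^i Y = 0.  To get (G) itself, argue by induction on  *)
(* i.  Let P be a free resolution of M and C_t the cokernel of                *)
(* P_(t-1)^* -> P_t^*.  The mapping cone of a chain map between the           *)
(* resolutions of C_t and C_(t+1) resolves E^t M.  The induction hypothesis   *)
(* embeds E^i (E^t M) in E^(i+2) C_(t+1), so by the mirror image all its      *)
(* cyclic submodules A satisfy E^k A = 0 for k <= i+1; a null-homotopy then   *)
(* shows that A = 0.  Finitely generated modules are handled through          *)
(* matrices: rows are left modules, columns right modules.                    *)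

Require Import Defs.
From HB Require Import structures.
From mathcomp Require Import all_boot all_order all_algebra.
From mathcomp Require Import boolp classical_sets functions cardinality fsbigop.
From mathcomp Require Import freeg.

Set Implicit Arguments.
Unset Strict Implicit.
Unset Printing Implicit Defensive.

Import GRing.Theory.
Local Open Scope ring_scope.
Local Open Scope quotient_scope.

(** Dimensions are compared through their finite upper bounds, in the cycle id L <= fin.dim <=
    Fin.dim <= id L.

    Fin.dim <= id L is [pd_le_inj_dim]: as long as a finite projective dimension exceeds id L, the
    vanishing of Ext into all direct sums of copies of L splits the last step of the resolution
    ([pd_le_drop]).

    id L <= fin.dim is [vanishes_above_little]. If E_(m+1) is nonzero in the minimal resolution E,
    then [ext_nonvanish] gives a cyclic M with T = Ext^(m+1)(M, L) nonzero. The mapping cone [cone]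
    represents T. Its dual is exact in degrees up to m+1 ([cone_rows_exact]), hence truncates to a
    finite free resolution of a finitely generated left module N; dualizing once more recovers T as
    Ext^(m+1)(N, L), so pd N is finite and at least m+1.

    The exactness of the dual is where the flat dimensions enter. By [tor_vanish] and
    [ext_sub_hom_vanish], a cyclic submodule of Ext^(j+1)(X, L) has no nonzero map to E_k for k <=
    j, so its Ext^k into L vanish too ([ext_sub_grade]). In [cone_row_exact] the null-homotopy of
    [zigzag] turns this vanishing into the vanishing of the submodule itself. *)

(** * Submodules, cokernels and factorization of linear maps *)

Section LinearMaps.
Variable L : pzRingType.

Section Make.
Variables (U V : lmodType L) (f : U -> V).
Hypothesis fD : forall a x y, f (a *: x + y) = a *: f x + f y.

(* Linearity is kept as an argument, so that the instance below is found.     *)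
Definition linear_of : U -> V := let _ := fD in f.

Lemma linear_of_linear : linear linear_of. Proof. exact: fD. Qed.

HB.instance Definition _ :=
  GRing.isLinear.Build L U V *:%R linear_of linear_of_linear.

Definition mklin : {linear U -> V} := linear_of.

Lemma mklinE x : mklin x = f x. Proof. by []. Qed.

End Make.

Section Submodule.
Variables (V : lmodType L) (P : V -> Prop).
Hypothesis P_closed : P 0 /\ forall a x y, P x -> P y -> P (a *: x + y).

Definition sub_pred : {pred V} := let _ := P_closed in fun x => `[< P x >].

Lemma sub_predP x : reflect (P x) (x \in sub_pred).
Proof. exact: asboolP. Qed.

Lemma sub_pred_closed : submod_closed sub_pred.
Proof.
split; first exact/sub_predP/(proj1 P_closed).
by move=> a x y /sub_predP hx /sub_predP hy; apply/sub_predP/(proj2 P_closed).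
Qed.

HB.instance Definition _ := GRing.isSubmodClosed.Build L V sub_pred
  sub_pred_closed.

Record submod := Submod { submod_val : V; _ : submod_val \in sub_pred }.

HB.instance Definition _ := [isSub for submod_val].
HB.instance Definition _ := [Choice of submod by <:].
HB.instance Definition _ := [SubChoice_isSubLmodule of submod by <:].

Definition submod_incl : {linear submod -> V} := \val.

Lemma submod_incl_inj : injective submod_incl. Proof. exact: val_inj. Qed.

Lemma submod_inclP x : P (submod_incl x).
Proof. exact/sub_predP/(valP x). Qed.

Lemma submod_inclS x : P x -> exists y, submod_incl y = x.
Proof. by move=> /sub_predP hx; exists (Submod hx). Qed.

End Submodule.

Section Cokernel.
Variables (U V : lmodType L) (f : {linear U -> V}).

Definition im_pred : {pred V} := fun x => `[< exists u, f u = x >].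

Lemma im_predP x : reflect (exists u, f u = x) (x \in im_pred).
Proof. exact: asboolP. Qed.

Lemma im_pred_closed : zmod_closed im_pred.
Proof.
split; first by apply/im_predP; exists 0; rewrite linear0.
move=> x y /im_predP [u <-] /im_predP [v <-].
by apply/im_predP; exists (u - v); rewrite linearB.
Qed.

HB.instance Definition _ := GRing.isZmodClosed.Build V im_pred im_pred_closed.

Definition coker := Quotient.quot im_pred.
HB.instance Definition _ := GRing.Zmodule.on coker.

Lemma coker_piE x y : \pi_coker x = \pi_coker y <-> exists u, f u = x - y.
Proof.
split=> [/eqP|h]; first by rewrite -Quotient.idealrBE => /im_predP.
by apply/eqP; rewrite -Quotient.idealrBE; apply/im_predP.
Qed.

Lemma coker_piD x y : \pi_coker (x + y) = \pi_coker x + \pi_coker y.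
Proof. exact: (@Quotient.pi_add _ im_pred). Qed.

Lemma coker_pi_surj y : exists x, y = \pi_coker x.
Proof. by exists (repr y); rewrite reprK. Qed.

Definition coker_scale a (x : coker) : coker := \pi_coker (a *: repr x).

Lemma coker_scale_pi a x : coker_scale a (\pi_coker x) = \pi_coker (a *: x).
Proof.
apply/coker_piE.
have /coker_piE [u hu] : \pi_coker (repr (\pi_coker x)) = \pi_coker x.
  by rewrite reprK.
by exists (a *: u); rewrite linearZ /= hu scalerBr.
Qed.

Lemma coker_scaleA a b x :
  coker_scale a (coker_scale b x) = coker_scale (a * b) x.
Proof. by have [y ->] := coker_pi_surj x; rewrite !coker_scale_pi scalerA. Qed.

Lemma coker_scale1 : left_id 1 coker_scale.
Proof.
by move=> x; have [y ->] := coker_pi_surj x; rewrite coker_scale_pi scale1r.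
Qed.

Lemma coker_scaleDr : right_distributive coker_scale +%R.
Proof.
move=> a x y; have [x' ->] := coker_pi_surj x; have [y' ->] := coker_pi_surj y.
by rewrite -coker_piD !coker_scale_pi scalerDr coker_piD.
Qed.

Lemma coker_scaleDl x : {morph coker_scale^~ x : a b / a + b}.
Proof.
move=> a b; have [y ->] := coker_pi_surj x.
by rewrite !coker_scale_pi scalerDl coker_piD.
Qed.

HB.instance Definition _ := GRing.Zmodule_isLmodule.Build L coker
  coker_scaleA coker_scale1 coker_scaleDr coker_scaleDl.

Lemma coker_proj_linear a x y :
  (\pi_coker (a *: x + y) : coker)
    = a *: (\pi_coker x : coker) + (\pi_coker y : coker).
Proof. by rewrite coker_piD -coker_scale_pi. Qed.

Definition coker_proj : {linear V -> coker} :=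
  mklin (f := fun x => \pi_coker x : coker) coker_proj_linear.

Lemma coker_projS y : exists x, coker_proj x = y.
Proof. by exists (repr y); rewrite mklinE reprK. Qed.

Lemma coker_proj0 x : coker_proj x = 0 <-> exists u, f u = x.
Proof.
rewrite -[0](linear0 coker_proj) !mklinE coker_piE.
by rewrite subr0.
Qed.

End Cokernel.

Lemma surj_section (U V : lmodType L) (p : {linear U -> V}) :
  (forall v, exists u, p u = v) -> exists s : V -> U, forall v, p (s v) = v.
Proof. by move=> /choice [s hs]; exists s. Qed.

Lemma factor_surj (U V W : lmodType L) (p : {linear U -> V})
    (g : {linear U -> W}) :
  (forall v, exists u, p u = v) -> (forall u, p u = 0 -> g u = 0) ->
  exists h : {linear V -> W}, forall u, h (p u) = g u.
Proof.
move=> /surj_section [s hs] pg.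
have E u u' : p u = p u' -> g u = g u'.
  move=> e; apply/eqP; rewrite -subr_eq0 -linearB; apply/eqP/pg.
  by rewrite linearB e subrr.
have lin a x y : g (s (a *: x + y)) = a *: g (s x) + g (s y).
  by rewrite -linearP; apply: E; rewrite hs linearP !hs.
by exists (mklin lin) => u; rewrite mklinE; apply: E; rewrite hs.
Qed.

Lemma image_factorization (U V : lmodType L) (f : {linear U -> V}) :
  exists (W : lmodType L) (q : {linear U -> W}) (i : {linear W -> V}),
    [/\ forall w, exists u, q u = w, injective i & forall u, i (q u) = f u].
Proof.
have cl : (exists u, f u = 0) /\
    forall a x y, (exists u, f u = x) -> (exists u, f u = y) ->
      exists u, f u = a *: x + y.
  split; first by exists 0; rewrite linear0.
  by move=> a x y [u <-] [v <-]; exists (a *: u + v); rewrite linearP.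
have H u : exists y, submod_incl cl y = f u.
  by apply: (submod_inclS cl); exists u.
case/choice: H => q hq.
have qlin a x y : q (a *: x + y) = a *: q x + q y.
  by apply: (@submod_incl_inj _ _ cl); rewrite linearP !hq linearP.
exists (submod cl), (mklin qlin), (submod_incl cl); split=> //.
  move=> y; have [u hu] := submod_inclP y.
  by exists u; apply: (@submod_incl_inj _ _ cl); rewrite hq.
Qed.

(** Injectivity of [E] speaks of injections only, so [f] is replaced by the inclusion of its
    image. *)
Lemma injective_extend (E U V : lmodType L) (f : {linear U -> V})
    (g : {linear U -> E}) :
  injective_module E -> (forall u, f u = 0 -> g u = 0) ->
  exists h : {linear V -> E}, forall u, h (f u) = g u.
Proof.
move=> inj fg; have [W [q [i [qS iI iq]]]] := image_factorization f.
have [|h hh] := factor_surj (g := g) qS.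
  by move=> u qu; apply: fg; rewrite -iq qu linear0.
have [k hk] := inj _ _ i h iI.
by exists k => u; rewrite -iq hk hh.
Qed.

(** Projectivity speaks of surjections only, so both maps are first restricted to the image of
    [p]. *)
Lemma projective_lift (P U V : lmodType L) (p : {linear U -> V})
    (f : {linear P -> V}) :
  projective_module P -> (forall x, exists u, p u = f x) ->
  exists g : {linear P -> U}, forall x, p (g x) = f x.
Proof.
move=> proj pf.
have cl : (exists u, p u = 0) /\
    forall a x y, (exists u, p u = x) -> (exists u, p u = y) ->
      exists u, p u = a *: x + y.
  split; first by exists 0; rewrite linear0.
  by move=> a x y [u <-] [v <-]; exists (a *: u + v); rewrite linearP.
have cor (W : lmodType L) (h : {linear W -> V}) :
    (forall w, exists u, p u = h w) ->
    exists h' : {linear W -> submod cl}, forall w, submod_incl cl (h' w) = h w.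
  move=> H.
  have {}H w : exists y, submod_incl cl y = h w.
    by apply: (submod_inclS cl).
  case/choice: H => h' hh'.
  have lin a x y : h' (a *: x + y) = a *: h' x + h' y.
    by apply: (@submod_incl_inj _ _ cl); rewrite linearP !hh' linearP.
  by exists (mklin lin).
have [p' hp'] := cor _ p (fun u => ex_intro _ u erefl).
have [f' hf'] := cor _ f pf.
have [|g hg] := proj _ _ p' f'.
  move=> y; have [u hu] := submod_inclP y.
  by exists u; apply: (@submod_incl_inj _ _ cl); rewrite hp'.
by exists g => x; rewrite -hp' hg hf'.
Qed.

Section Kernel.
Variables (U V : lmodType L) (f : {linear U -> V}).

Lemma ker_closed :
  f 0 = 0 /\ forall a x y, f x = 0 -> f y = 0 -> f (a *: x + y) = 0.
Proof.
split; first exact: linear0.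
by move=> a x y hx hy; rewrite linearP hx hy scaler0 addr0.
Qed.

Definition kermod : lmodType L := submod ker_closed.
Definition ker_incl : {linear kermod -> U} := submod_incl ker_closed.

Lemma ker_incl_inj : injective ker_incl. Proof. exact: submod_incl_inj. Qed.

Lemma ker_inclK x : f (ker_incl x) = 0. Proof. exact: (submod_inclP x). Qed.

Lemma ker_inclS x : f x = 0 -> exists y, ker_incl y = x.
Proof. exact: submod_inclS. Qed.

Lemma ker_corestrict (W : lmodType L) (g : {linear W -> U}) :
  (forall w, f (g w) = 0) ->
  exists h : {linear W -> kermod}, forall w, ker_incl (h w) = g w.
Proof.
move=> H.
have {}H w : exists y, ker_incl y = g w by apply: ker_inclS.
case/choice: H => h hh.
have lin a x y : h (a *: x + y) = a *: h x + h y.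
  by apply: ker_incl_inj; rewrite linearP !hh linearP.
by exists (mklin lin).
Qed.

End Kernel.

End LinearMaps.

(** * Free modules of rows, matrices as maps, and Noetherian modules *)

Section RowMaps.
Variable L : pzRingType.
Variable V : lmodType L.

Section RowLin.
Variables (n : nat) (x : 'I_n -> V).

Lemma rowlin_linear a (u v : 'rV[L]_n) :
  \sum_i (a *: u + v) 0 i *: x i
    = a *: (\sum_i u 0 i *: x i) + \sum_i v 0 i *: x i.
Proof.
rewrite scaler_sumr -big_split /=; apply: eq_bigr => i _.
by rewrite !mxE scalerDl scalerA.
Qed.

Definition rowlin : {linear 'rV[L]_n -> V} := mklin rowlin_linear.

Lemma rowlinE v : rowlin v = \sum_i v 0 i *: x i. Proof. by []. Qed.

Lemma rowlin_delta i : rowlin (delta_mx 0 i) = x i.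
Proof.
rewrite rowlinE (bigD1 i) //= big1 => [|j ji]; rewrite mxE !eqxx.
  by rewrite scale1r addr0.
by rewrite /= (negbTE ji) scale0r.
Qed.

End RowLin.

Lemma lin_rowE n (f : {linear 'rV[L]_n -> V}) v :
  f v = \sum_i v 0 i *: f (delta_mx 0 i).
Proof.
rewrite {1}(row_sum_delta v) linear_sum; apply: eq_bigr => i _.
by rewrite linearZ.
Qed.

End RowMaps.

Section Rows.
Variable L : pzRingType.

Lemma projective_row n : projective_module ('rV[L]_n : lmodType L).
Proof.
move=> U V p f /surj_section [s hs].
exists (rowlin (fun i => s (f (delta_mx 0 i)))) => v.
rewrite (lin_rowE f) rowlinE linear_sum; apply: eq_bigr => i _.
by rewrite linearZ /= hs.
Qed.

Section MxLin.
Variables (m n : nat) (A : 'M[L]_(m, n)).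

Lemma mxlin_linear a (u v : 'rV[L]_m) :
  (a *: u + v) *m A = a *: (u *m A) + v *m A.
Proof. by rewrite mulmxDl scalemxAl. Qed.

Definition mxlin : {linear 'rV[L]_m -> 'rV[L]_n} := mklin mxlin_linear.

Lemma mxlinE u : mxlin u = u *m A. Proof. by []. Qed.

End MxLin.

Lemma lin_mxE m n (f : {linear 'rV[L]_m -> 'rV[L]_n}) :
  exists A : 'M[L]_(m, n), forall u, f u = u *m A.
Proof.
exists (\matrix_i f (delta_mx 0 i)) => u.
rewrite lin_rowE mulmx_sum_row; apply: eq_bigr => i _.
by rewrite rowK.
Qed.

Lemma mulmx_rowwise m n p (A : 'M[L]_(m, n)) (U : 'M_(p, n)) :
  (forall i, exists w, row i U = w *m A) -> exists W, U = W *m A.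
Proof.
move=> /choice [h hh]; exists (\matrix_i h i); apply/row_matrixP => i.
by rewrite row_mul rowK.
Qed.

Lemma mulmx_colwise m n p (A : 'M[L]_(m, n)) (U : 'M_(m, p)) :
  (forall j, exists w, col j U = A *m w) -> exists W, U = A *m W.
Proof.
move=> /choice [h hh]; exists (\matrix_(i, j) h j i 0); apply/matrixP => i j.
have /colP /(_ i) := hh j; rewrite !mxE => ->.
by apply: eq_bigr => k _; rewrite !mxE.
Qed.

Definition closed_sub (V : lmodType L) (Q : V -> Prop) :=
  Q 0 /\ forall a x y, Q x -> Q y -> Q (a *: x + y).

Lemma closed_sumZ (V : lmodType L) (Q : V -> Prop) n (c : 'I_n -> L) x :
  closed_sub Q -> (forall i, Q (x i)) -> Q (\sum_i c i *: x i).
Proof.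
move=> [Q0 QD] Qx; apply: (big_ind Q) => // [u v hu hv|i _].
  by rewrite -[u]scale1r; apply: QD.
by rewrite -[_ *: _]addr0; apply: QD.
Qed.

Lemma closed_rowlin (V : lmodType L) (Q : V -> Prop) n (x : 'I_n -> V) v :
  closed_sub Q -> (forall i, Q (x i)) -> Q (rowlin x v).
Proof. exact: closed_sumZ. Qed.

Definition noetherian_module (V : lmodType L) :=
  forall Q : V -> Prop, closed_sub Q ->
  exists n (x : 'I_n -> V), forall y, Q y <-> exists v, rowlin x v = y.

Lemma noetherian_regular :
  left_noetherian L -> noetherian_module (L^o : lmodType L).
Proof.
move=> acc Q Qcl; apply: contrapT => notfg.
pose span (s : seq L^o) y := exists v, rowlin (fun i : 'I_(size s) => s`_i) v = y.
have span_closed s : closed_sub (span s).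
  split; first by exists 0; rewrite linear0.
  by move=> a _ _ [v <-] [w <-]; exists (a *: v + w); rewrite linearP.
(* The condition on [s] sits under the existential so that choice yields a function [F] on all
   sequences; iterating it from the empty sequence gives a strictly increasing chain of spans inside
   [Q]. *)
have next s : exists a, (forall i, (i < size s)%N -> Q s`_i) -> Q a /\ ~ span s a.
  apply: contrapT => /forallNP H; apply: notfg.
  exists (size s), (fun i : 'I_(size s) => s`_i) => y; split.
    move=> Qy; apply: contrapT => ny; apply: (H y) => _; split => //.
  move=> [v <-]; apply: closed_rowlin => // i.
  by apply: contrapT => ni; apply: (H 0) => /(_ _ (ltn_ord i)).
case/choice: next => F hF.
pose s k := iter k (fun s => rcons s (F s)) [::].
have sS k : s k.+1 = rcons (s k) (F (s k)) by [].
have sQ k i : (i < size (s k))%N -> Q (s k)`_i.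
  elim: k i => [//|k IH] i; rewrite sS size_rcons ltnS nth_rcons.
  case: ltngtP => // hi _; first exact: IH.
  by case: (hF (s k) (IH)).
have mem k i : (i < size (s k))%N -> span (s k) (s k)`_i.
  by move=> hi; exists (delta_mx 0 (Ordinal hi)); rewrite rowlin_delta.
have sub k y : span (s k) y -> span (s k.+1) y.
  move=> [v <-]; apply: closed_rowlin => // i.
  have hi : (i < size (s k.+1))%N by rewrite sS size_rcons ltnS ltnW.
  by have := mem k.+1 i hi; rewrite {2}sS nth_rcons ltn_ord.
have [n /(_ n.+1 (leqnSn n)) hn] :=
  acc (fun k => [pred y | `[< span (s k) y >]])
    (fun k => sub_pred_closed (span_closed (s k)))
    (fun k y hy => (introT (asboolP _) (sub k y (elimT (asboolP _) hy)))).
have [_ []] := hF (s n) (sQ n).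
have hi : (size (s n) < size (s n.+1))%N by rewrite sS size_rcons.
have := mem n.+1 _ hi; rewrite {2}sS nth_rcons ltnn eqxx => /asboolP h.
by have := hn (F (s n)); rewrite !inE h => /esym/asboolP.
Qed.

(** Generators of the preimage of [Q] in [U], together with lifts to [Q] of generators of the image
    of [Q] in [W], generate [Q]. *)
Lemma noetherian_extension (U V W : lmodType L) (j : {linear U -> V})
    (p : {linear V -> W}) :
  (forall x, p x = 0 -> exists u, j u = x) ->
  noetherian_module U -> noetherian_module W -> noetherian_module V.
Proof.
move=> ex hU hW Q Qcl; have [Q0 QD] := Qcl.
have [|n [x hx]] := hU (fun u => Q (j u)).
  by split; [rewrite linear0|move=> a u v hu hv; rewrite linearP; apply: QD].
have [|m [y hy]] := hW (fun w => exists2 v, Q v & p v = w).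
  split; first by exists 0; rewrite ?linear0.
  move=> a _ _ [v hv <-] [w hw <-].
  by exists (a *: v + w); rewrite ?linearP //; apply: QD.
have H i : exists v, Q v /\ p v = y i.
  have [|v] := (hy (y i)).2; first by exists (delta_mx 0 i); rewrite rowlin_delta.
  by exists v.
case/choice: H => z hz.
pose xz (i : 'I_(n + m)) : V :=
  match fintype.split i with inl k => j (x k) | inr k => z k end.
exists (n + m)%N, xz.
have E v : rowlin xz v = j (rowlin x (lsubmx v)) + rowlin z (rsubmx v).
  rewrite !rowlinE big_split_ord /= linear_sum; congr (_ + _); apply: eq_bigr => i _.
    by rewrite linearZ /= mxE /xz (unsplitK (inl i)).
  by rewrite mxE /xz (unsplitK (inr i)).
have Qz v : Q (rowlin z v) by apply: closed_rowlin => // i; case: (hz i).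
move=> w; split=> [Qw|[v <-]]; last first.
  rewrite E -[j _]scale1r; apply: QD => //.
  by apply/(hx _).2; eexists.
have [|v hv] := (hy (p w)).1; first by exists w.
have pz : p (rowlin z v) = rowlin y v.
  rewrite !rowlinE linear_sum; apply: eq_bigr => i _; rewrite linearZ /=.
  by case: (hz i) => _ ->.
have [u hu] : exists u, j u = w - rowlin z v.
  by apply: ex; rewrite linearB pz hv subrr.
have [|t ht] := (hx u).1.
  by rewrite hu -[_ - _]addrC -scaleN1r; apply: QD.
exists (row_mx t v); rewrite E row_mxKl row_mxKr ht hu subrK //.
Qed.

Lemma noetherian_row n :
  left_noetherian L -> noetherian_module ('rV[L]_n : lmodType L).
Proof.
move=> acc; elim: n => [|n IH].
  move=> Q [Q0 _]; exists 0, (fun _ => 0) => y.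
  rewrite [y]thinmx0; split=> // _.
  by exists 0; rewrite linear0.
have jlin a (u v : 'rV[L]_n) :
    row_mx (0 : 'rV[L]_1) (a *: u + v) = a *: row_mx 0 u + row_mx 0 v.
  by rewrite scale_row_mx add_row_mx scaler0 addr0.
have plin a (u v : 'rV[L]_(1 + n)) :
    (a *: u + v) 0 0 = a *: (u 0 0 : L^o) + v 0 0 by rewrite !mxE.
apply: (@noetherian_extension _ _ _ (mklin jlin) (mklin (V := L^o) plin)) => //.
  move=> x; rewrite mklinE => hx; exists (rsubmx (x : 'rV_(1 + n))).
  rewrite mklinE -[RHS](hsubmxK (x : 'rV_(1 + n))); congr row_mx.
  apply/rowP=> i; rewrite !mxE ord1; rewrite -[LHS]hx; congr (x _ _).
  exact/val_inj.
exact: noetherian_regular.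
Qed.

Lemma noetherian_row_mx n (Q : 'rV[L]_n -> Prop) :
  left_noetherian L -> closed_sub Q ->
  exists m (A : 'M[L]_(m, n)), forall y, Q y <-> exists v, v *m A = y.
Proof.
move=> acc Qcl; have [m [x hx]] := noetherian_row acc Qcl.
have [A hA] := lin_mxE (rowlin x).
exists m, A => y; rewrite hx; split=> [[v <-]|[v <-]]; exists v;
  by rewrite hA.
Qed.

End Rows.

(** * Extended natural numbers and their finite bounds *)

Section Dimensions.

Lemma dim_le_least (P : nat -> Prop) n :
  dim_le (least P) n <-> exists2 k, (k <= n)%N & P k.
Proof.
rewrite /least; case: pselect => [h|h] /=; last first.
  by split=> // -[k _ Pk]; apply: h; exists k; apply/asboolP.
case: ex_minnP => m /asboolP Pm min; split=> [mn|[k kn Pk]]; first by exists m.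
by apply: leq_trans kn; apply: min; apply/asboolP.
Qed.

Lemma dim_le_trans x m n : (m <= n)%N -> dim_le x m -> dim_le x n.
Proof. by case: x => //= k mn km; apply: leq_trans mn. Qed.

Lemma dim_le_sup (S : option nat -> Prop) n :
  dim_le (dim_sup S) n <-> forall x, S x -> dim_le x n.
Proof.
rewrite dim_le_least; split=> [[k kn H] x /H|H]; last by exists n.
exact: dim_le_trans.
Qed.

Lemma dim_le_eq x y : (forall n, dim_le x n <-> dim_le y n) -> x = y.
Proof.
case: x y => [k|] [l|] //= H.
- by congr Some; apply/eqP; rewrite eqn_leq (H l).2 // (H k).1.
- by case: ((H k).1 (leqnn k)).
- by case: ((H l).2 (leqnn l)).
Qed.

End Dimensions.

(** * Projective dimension by iterated syzygies *)

Section ProjectiveDimension.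
Variable L : pzRingType.
Implicit Types M N : lmodType L.

(** The recursive form suits dimension shifting, one short exact sequence at a time; [pd_leP]
    identifies it with the existence of a resolution. *)
Fixpoint pd_le n M : Prop :=
  match n with
  | 0 => projective_module M
  | n.+1 => exists (K P : lmodType L) (j : {linear K -> P}) (p : {linear P -> M}),
      [/\ projective_module P, injective j, exact_at j p,
          forall x, exists y, p y = x & pd_le n K]
  end.

Lemma injective_linear (U V : lmodType L) (f : {linear U -> V}) :
  (forall x, f x = 0 -> x = 0) -> injective f.
Proof.
move=> H x y e; apply/eqP; rewrite -subr_eq0; apply/eqP/H.
by rewrite linearB e subrr.
Qed.

Lemma projective_retract (P M : lmodType L) (p : {linear P -> M})
    (s : {linear M -> P}) :
  projective_module P -> (forall x, p (s x) = x) -> projective_module M.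
Proof.
move=> Pproj ps U V q f qS.
have [g hg] := Pproj _ _ q (f \o p) qS.
by exists (g \o s) => x /=; rewrite hg /= ps.
Qed.

Section Cons.
Variables (M K P : lmodType L) (j : {linear K -> P}) (p : {linear P -> M}).
Variables (X : nat -> lmodType L) (d : forall i, {linear X i.+1 -> X i}).
Variable e : {linear X 0 -> K}.

Definition cons_obj i : lmodType L := if i is i'.+1 then X i' else P.

Definition cons_diff i : {linear cons_obj i.+1 -> cons_obj i} :=
  match i return {linear cons_obj i.+1 -> cons_obj i} with
  | 0 => j \o e
  | i'.+1 => d i'
  end.

Lemma left_resolution_cons (C : lmodType L -> Prop) :
  C P -> injective j -> exact_at j p -> (forall x, exists y, p y = x) ->
  left_resolution C d e -> @left_resolution L C M cons_obj cons_diff p.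
Proof.
move=> CP jI ex pS [CX eS ex0 exd]; split=> //; first by case.
  move=> y; rewrite ex; split=> [[k <-]|[x <-]]; last by exists (e x).
  by have [x <-] := eS k; exists x.
case=> [|i] /=; last exact: exd.
move=> y; rewrite -ex0 /=; split=> [|->]; last exact: linear0.
by rewrite -[0](linear0 j) => /jI.
Qed.

End Cons.

Section Tail.
Variables (M : lmodType L) (C : lmodType L -> Prop).
Variables (X : nat -> lmodType L) (d : forall i, {linear X i.+1 -> X i}).
Variable e : {linear X 0 -> M}.
Hypothesis res : left_resolution C d e.

Lemma left_resolution_tail :
  exists2 e' : {linear X 1 -> kermod e}, forall x, ker_incl e (e' x) = d 0 x &
  left_resolution C (X := fun i => X i.+1) (fun i => d i.+1) e'.
Proof.
case: res => CX eS ex0 exd.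
have [|e' he'] := @ker_corestrict _ _ _ e _ (d 0).
  by move=> w; apply/ex0; exists w.
exists e' => //; split=> //.
  move=> x; have /ex0 [y hy] := ker_inclK x.
  by exists y; apply: ker_incl_inj; rewrite he'.
move=> y; rewrite -exd -he' -[0 in X in _ <-> X](linear0 (ker_incl e)).
by split=> [->|/ker_incl_inj].
Qed.

End Tail.

Lemma row0_eq0 (x : 'rV[L]_0) : x = 0. Proof. exact: thinmx0. Qed.

Lemma zero_linear (U V : lmodType L) (a : L) (x y : U) :
  (0 : V) = a *: 0 + 0.
Proof. by rewrite scaler0 addr0. Qed.

Definition zero_map (U V : lmodType L) : {linear U -> V} :=
  mklin (@zero_linear U V).

Lemma pd_leP n M :
  pd_le n M <-> exists X d e,
    @left_resolution L (@projective_module L) M X d e /\ vanishes_above X n.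
Proof.
elim: n M => [|n IH] M.
  split=> [Mproj|[X [d [e [[CX eS ex0 exd] van]]]]]; last first.
    have eI : injective e.
      apply: injective_linear => x /ex0 [y <-].
      by rewrite (van 1%N isT y) linear0.
    have [|s hs] := factor_surj (p := e) (g := idfun) eS.
      by move=> u /= hu; apply: eI; rewrite hu linear0.
    apply: (@projective_retract _ _ e s) => // x.
    by have [y <-] := eS x; rewrite hs.
  exists (cons_obj M (fun _ => 'rV[L]_0)).
  exists (cons_diff (zero_map _ M) (fun _ => zero_map _ _) (zero_map _ 'rV_0)).
  exists idfun; split; last by case=> // i _ x; apply: row0_eq0.
  apply: left_resolution_cons => //.
  - by move=> x y _; rewrite (row0_eq0 x) (row0_eq0 y).
  - by move=> y; split=> /= [->|[x <-]] //; exists 0.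
  - by move=> x; exists x.
  - split; [by move=> i; apply: projective_row| | |].
    + by move=> x; exists 0; rewrite [RHS]row0_eq0.
    + by move=> y; split=> // _; exists 0; rewrite [RHS]row0_eq0.
    + by move=> i y; split=> // _; exists 0; rewrite [RHS]row0_eq0.
split=> [[K [P [j [p [Pproj jI ex pS /IH [X [d [e [res van]]]]]]]]]|].
  exists (cons_obj P X), (cons_diff j d e), p.
  split; first exact: left_resolution_cons.
  by case=> // i hi; apply: van.
move=> [X [d [e [res van]]]].
have [e' he' res'] := left_resolution_tail res.
case: res => CX eS ex0 exd.
exists (kermod e), (X 0), (ker_incl e), e; split=> //.
- move=> y; split=> [/ker_inclS//|[x <-]]; exact: ker_inclK.
- apply/IH; exists (fun i => X i.+1), (fun i => d i.+1), e'; split=> //.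
  by move=> i hi; apply: van.
Qed.

Lemma pd_le_leq m n M : (m <= n)%N -> pd_le m M -> pd_le n M.
Proof.
move=> mn /pd_leP [X [d [e [res van]]]]; apply/pd_leP; exists X, d, e.
by split=> // i hi; apply: van; apply: leq_ltn_trans hi.
Qed.

Lemma proj_dim_le n M : dim_le (proj_dim M) n <-> pd_le n M.
Proof.
rewrite dim_le_least; split=> [[k kn]|H]; first by move/pd_leP; apply: pd_le_leq.
by exists n => //; apply/pd_leP.
Qed.

Lemma proj_dim_finite M : proj_dim M <> None <-> exists n, pd_le n M.
Proof.
split=> [|[n /proj_dim_le]]; last by case: proj_dim.
case E: proj_dim => [k|//] _; exists k; apply/proj_dim_le; rewrite E /=.
exact: leqnn.
Qed.

End ProjectiveDimension.

(** * Vanishing of Ext, by injective coresolutions and by projective resolutions *)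

Section ExtVanishing.
Variable L : pzRingType.
Variables (E : nat -> lmodType L) (d : forall i, {linear E i -> E i.+1}).

(* Ext^q(M, ker (d 0)) = 0, computed from the injective coresolution E. *)
Definition ext_vanish q (M : lmodType L) : Prop :=
  match q with
  | 0 => forall f : {linear M -> E 0},
      (forall x, d 0 (f x) = 0) -> forall x, f x = 0
  | q.+1 => forall f : {linear M -> E q.+1},
      (forall x, d q.+1 (f x) = 0) ->
      exists g : {linear M -> E q}, forall x, d q (g x) = f x
  end.

Lemma ext_vanish_zero q M : (forall x : E q, x = 0) -> ext_vanish q M.
Proof.
case: q => [|q] E0 f _; first by move=> x; apply: E0.
by exists (zero_map _ _) => x; rewrite linear0; apply/esym/E0.
Qed.

Hypothesis E_inj : forall i, injective_module (E i).
Hypothesis E_exact : forall i, exact_at (d i) (d i.+1).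

Lemma coresolutionK i x : d i.+1 (d i x) = 0.
Proof. by apply/E_exact; exists x. Qed.

Section ShortExact.
Variables (K P M : lmodType L) (j : {linear K -> P}) (p : {linear P -> M}).
Hypothesis P_proj : projective_module P.
Hypothesis j_inj : injective j.
Hypothesis jp_exact : exact_at j p.
Hypothesis p_surj : forall x, exists y, p y = x.

(** Surjectivity of Hom(P, Z) -> Hom(K, Z) for Z = ker (d q), that is, Ext^1(M, Z) = 0. It is the
    common ground for shifting in the first and in the second argument of Ext. *)
Definition ext1_vanish q :=
  forall f : {linear K -> E q}, (forall x, d q (f x) = 0) ->
  exists2 g : {linear P -> E q}, forall x, d q (g x) = 0 & forall x, g (j x) = f x.

Lemma short_exactK x : p (j x) = 0.
Proof. by apply/jp_exact; exists x. Qed.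

(** Extend a cocycle on [K] to [P]: the differential of the extension descends to a cocycle on [M],
    and it is a coboundary there exactly when the extension can be corrected to a cocycle. *)
Lemma ext_vanish_quotient q : ext_vanish q.+1 M <-> ext1_vanish q.
Proof.
split=> [H f df|H f df].
  have [g hg] := E_inj f j_inj.
  have [|h hh] := factor_surj (p := p) (g := d q \o g) p_surj.
    by move=> u /jp_exact [x <-] /=; rewrite hg.
  have [|k hk] := H h.
    by move=> x; have [y <-] := p_surj x; rewrite hh coresolutionK.
  have lin a x y : g (a *: x + y) - k (p (a *: x + y))
      = a *: (g x - k (p x)) + (g y - k (p y)).
    by rewrite !linearP scalerDr addrACA.
  exists (mklin lin) => x; rewrite mklinE.
    by rewrite linearB hk hh subrr.
  by rewrite short_exactK linear0 subr0 hg.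
have [|g hg] := projective_lift (p := d q) (f := f \o p) P_proj.
  by move=> x; apply/E_exact; rewrite df.
have [|h dh hj] := H (g \o j).
  by move=> x /=; rewrite hg /= short_exactK linear0.
have lin a x y : g (a *: x + y) - h (a *: x + y)
    = a *: (g x - h x) + (g y - h y).
  by rewrite !linearP scalerDr addrACA.
have [|k hk] := factor_surj (p := p) (g := mklin lin) p_surj.
  by move=> u /jp_exact [x <-]; rewrite mklinE hj /= subrr.
exists k => x; have [y <-] := p_surj x.
by rewrite hk mklinE linearB dh subr0 hg.
Qed.

Lemma ext_vanish_sub q : ext_vanish q.+1 K <-> ext1_vanish q.+1.
Proof.
split=> H f df.
  have [g hg] := H f df.
  have [h hh] := E_inj g j_inj.
  by exists (d q \o h) => x /=; rewrite ?coresolutionK ?hh.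
have [g dg gj] := H f df.
have [|h hh] := projective_lift (p := d q) (f := g) P_proj.
  by move=> x; apply/E_exact.
by exists (h \o j) => x /=; rewrite hh gj.
Qed.

Lemma ext_vanish_shift q : ext_vanish q.+2 M <-> ext_vanish q.+1 K.
Proof. by rewrite ext_vanish_quotient ext_vanish_sub. Qed.

End ShortExact.

Lemma pd_le_ext_vanish n m M : pd_le n M -> (n < m)%N -> ext_vanish m M.
Proof.
elim: n m M => [|n IH] [//|m] M.
  move=> Mproj _ f df.
  have [|g hg] := projective_lift (p := d m) (f := f) Mproj; last by exists g.
  by move=> x; apply/E_exact.
case: m => [//|m] [K [P [j [p [Pproj jI ex pS pdK]]]]] nm.
by apply/(ext_vanish_shift Pproj jI ex pS); apply: IH.
Qed.

Lemma ext_vanish_resolution (M : lmodType L) X dX e m :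
  @left_resolution L (@projective_module L) M X dX e ->
  ext_vanish m.+1 M <->
  forall f : {linear X m.+1 -> E 0}, (forall x, d 0 (f x) = 0) ->
    (forall x, f (dX m.+1 x) = 0) ->
  exists2 g : {linear X m -> E 0},
    forall x, d 0 (g x) = 0 & forall x, g (dX m x) = f x.
Proof.
elim: m M X dX e => [|m IH] M X dX e res.
  have [e' he' [_ e'S ex' _]] := left_resolution_tail res.
  case: res => Xproj eS ex exd.
  have ex1 : exact_at (ker_incl e) e.
    by move=> y; split=> [/ker_inclS//|[x <-]]; apply: ker_inclK.
  rewrite (ext_vanish_quotient (Xproj 0) (@ker_incl_inj _ _ _ e) ex1 eS).
  split=> H f df.
    move=> dXf.
    have [|h hh] := factor_surj (p := e') (g := f) e'S.
      by move=> u /ex' [x <-].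
    have [|g dg hg] := H h.
      by move=> x; have [y <-] := e'S x; rewrite hh.
    by exists g => // x; rewrite -he' hg hh.
  have [||g dg hg] := H (f \o e').
  - by move=> x /=.
  - move=> x /=; have -> : e' (dX 1 x) = 0 by apply/ex'; exists x.
    exact: linear0.
  - exists g => // x; have [y <-] := e'S x.
    by rewrite he' hg.
have [e' he' res'] := left_resolution_tail res.
case: res => Xproj eS ex exd.
have ex1 : exact_at (ker_incl e) e.
  by move=> y; split=> [/ker_inclS//|[x <-]]; apply: ker_inclK.
rewrite (ext_vanish_shift (Xproj 0) (@ker_incl_inj _ _ _ e) ex1 eS).
exact: (IH _ _ _ _ res').
Qed.

End ExtVanishing.

(** * Baer's criterion and direct sums of injectives *)

Section Baer.
Variable L : pzRingType.

Definition baer (E : lmodType L) : Prop :=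
  forall (Q : L^o -> Prop) (f : L^o -> E), closed_sub Q ->
    (forall a x y, Q x -> Q y -> f (a *: x + y) = a *: f x + f y) ->
  exists e, forall r : L, Q r -> f r = r *: e.

Section Extension.
Variables (E U V : lmodType L) (j : {linear U -> V}) (f : {linear U -> E}).
Hypothesis j_inj : injective j.

(** Partial extensions of [f] along [j] are encoded by their graphs. For a submodule of [V * E],
    being single-valued reduces to the fibre over 0. *)
Definition extension_graph (G : V * E -> Prop) : Prop :=
  [/\ closed_sub G, forall y, G (0, y) -> y = 0 & forall u, G (j u, f u)].

Lemma graph_functional G x y y' :
  extension_graph G -> G (x, y) -> G (x, y') -> y = y'.
Proof.
move=> [[G0 GD] Gf _] hy hy'; apply/eqP; rewrite -subr_eq0; apply/eqP/Gf.
rewrite (_ : (0, _) = (-1) *: (x, y') + (x, y)); first exact: GD.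
rewrite scaleN1r -[- (x, y') + _]/(- x + x, - y' + y).
by rewrite addNr [- y' + y]addrC.
Qed.

Lemma base_graph : extension_graph (fun z => exists u, (j u, f u) = z).
Proof.
split; last by move=> u; exists u.
  split; first by exists 0; rewrite !linear0.
  move=> a _ _ [u <-] [v <-]; exists (a *: u + v).
  by rewrite !linearP.
move=> y [u [hu <-]]; suff -> : u = 0 by rewrite linear0.
by apply: j_inj; rewrite hu linear0.
Qed.

Lemma maximal_graph : exists2 G, extension_graph G &
  forall H, extension_graph H -> (forall z, G z -> H z) -> forall z, H z -> G z.
Proof.
pose T := {G : V * E -> Prop | extension_graph G}.
pose R (s t : T) := `[< forall z, sval s z -> sval t z >].
have [|||A tot|[G hG] max] := @Zorn T R.
- by move=> t; apply/asboolP.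
- by move=> r s t /asboolP rs /asboolP st; apply/asboolP => z /rs /st.
- move=> [G hG] [H hH] /asboolP /= GH /asboolP /= HG.
  have e : G = H by apply: funext => z; apply: propext; split; [apply: GH|apply: HG].
  by subst H; congr exist; apply: Prop_irrelevance.
- pose t0 : T := exist _ _ base_graph.
  (* The base graph joins the chain so that the union is a graph even for the empty chain. *)
  pose B (s : T) := A s \/ s = t0.
  have t0R s : R t0 s.
    by apply/asboolP => z /= [u <-]; case: s => [G []] /=.
  have Btot s t : B s -> B t -> R s t \/ R t s.
    move=> [As|->] [At|->]; [|by right|by left|by left].
    by case: (tot s t As At) => ->; [left|right].
  have ok : extension_graph (fun z => exists2 s, B s & sval s z).
    split; last by move=> u; exists t0; [right|exists u].
    - split; first by exists t0; [right|exists 0; rewrite !linear0].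
      move=> a x y [s Bs sx] [t Bt ty].
      case: (Btot s t Bs Bt) => /asboolP h.
        by exists t => //; case: (svalP t) => -[_ D] _ _; apply: D => //; apply: h.
      by exists s => //; case: (svalP s) => -[_ D] _ _; apply: D => //; apply: h.
    - by move=> y [s _]; case: (svalP s) => _ + _; apply.
  exists (exist _ _ ok) => s As; apply/asboolP => z sz /=.
  by exists s => //; left.
exists G => // H hH GH z; have := max (exist _ H hH).
by move=> /(_ (introT (asboolP _) GH)) /(congr1 sval) /= ->.
Qed.

Lemma baer_extend : baer E -> exists g : {linear V -> E}, forall x, g (j x) = f x.
Proof.
move=> bE; have [G okG max] := maximal_graph.
have [[G0 GD] Gf Gj] := okG.
have total v : exists y, G (v, y).
  pose Q : L^o -> Prop := fun r : L => exists y, G (r *: v, y).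
  have Qcl : closed_sub Q.
    split; first by exists 0; rewrite scale0r.
    move=> a r s [y hy] [y' hy']; exists (a *: y + y').
    by rewrite scalerDl -scalerA; apply: (GD a (_, _) (_, _)).
  have H (r : L) : exists y, Q r -> G (r *: v, y).
    by have [[y hy]|nQ] := EM (Q r); [exists y|exists 0].
  case/choice: H => h hh.
  have [|e he] := bE Q h Qcl.
    move=> a x y Qx Qy; apply: (graph_functional okG (x := (a * x + y : L) *: v)).
      by apply/hh/Qcl.2.
    by rewrite scalerDl -scalerA; apply: (GD a (_, _) (_, _)); apply: hh.
  (* Adjoining the point [(v, e)] keeps the graph single-valued, because [e] induces the values of
     [G] on the multiples of [v] in its domain; maximality then puts [(v, e)] in [G]. *)
  pose H z := exists r w, G w /\ z = r *: (v, e) + w.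
  exists e; apply: (max H); last 1 first.
  - by exists 1, 0; rewrite scale1r addr0.
  - split; last by move=> u; exists 0, (j u, f u); rewrite scale0r add0r.
    + split; first by exists 0, 0; rewrite scale0r addr0.
      move=> a _ _ [r [w [Gw ->]]] [r' [w' [Gw' ->]]].
      exists (a * r + r'), (a *: w + w'); split; first exact: GD.
      by rewrite scalerDr addrACA scalerA -scalerDl.
    + move=> y [r [[x y'] [Gw [hx ->]]]].
      have hr : G (r *: v, - y').
        have -> : r *: v = - x by apply/eqP; rewrite -addr_eq0 -hx.
        by have := GD (-1) _ _ Gw G0; rewrite addr0 scaleN1r.
      have Qr : Q r by exists (- y').
      have := graph_functional okG hr (hh r Qr).
      by rewrite (he r Qr) => <-; rewrite addNr.
  - by move=> z Gz; exists 0, z; rewrite scale0r add0r.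
case/choice: total => g hg.
have lin a x y : g (a *: x + y) = a *: g x + g y.
  apply: (graph_functional okG (hg _)).
  exact: (GD a (x, g x) (y, g y)).
exists (mklin lin) => x; rewrite mklinE.
exact: (graph_functional okG (hg _) (Gj x)).
Qed.

End Extension.

Lemma baer_injective (E : lmodType L) : baer E -> injective_module E.
Proof. by move=> bE U V j f jI; apply: baer_extend. Qed.

Lemma injective_baer (E : lmodType L) : injective_module E -> baer E.
Proof.
move=> Einj Q f Qcl fQ.
have lin a x y : f (submod_incl Qcl (a *: x + y))
    = a *: f (submod_incl Qcl x) + f (submod_incl Qcl y).
  by rewrite linearP fQ //; apply: submod_inclP.
have [g hg] := Einj _ _ (submod_incl Qcl) (mklin lin) (@submod_incl_inj _ _ _ Qcl).
exists (g 1) => r /(submod_inclS Qcl) [x <-].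
rewrite -[LHS]/(mklin lin x) -hg -linearZ /=; congr (g _).
by rewrite -[RHS]/(_ * 1) mulr1.
Qed.

End Baer.

Section DirectSum.
Variables (L : pzRingType) (I : choiceType).

Section Def.
Variable E : lmodType L.

Definition finite_support (f : I -> E) : Prop := finite_set [set i | f i <> 0].

Lemma finite_support_closed :
  finite_support 0 /\ forall a (f g : I -> E),
    finite_support f -> finite_support g -> finite_support (a *: f + g).
Proof.
split.
  by apply: sub_finite_set (finite_set0 I) => i /=.
move=> a f g hf hg; have := hf; have := hg; rewrite /finite_support.
move=> Fg Ff; pose S := ([set i | f i <> 0] `|` [set i | g i <> 0])%classic.
apply: (@sub_finite_set _ _ S).
  move=> i /= h; apply: contrapT => /not_orP [/contrapT fi /contrapT gi].
  by apply: h; rewrite -[LHS]/(a *: f i + g i) fi gi scaler0 addr0.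
by rewrite finite_setU.
Qed.

Definition dsum : lmodType L := submod finite_support_closed.

Definition dsum_fun : {linear dsum -> (I -> E)} :=
  submod_incl finite_support_closed.

Definition dsum_coord i (x : dsum) : E := dsum_fun x i.

Lemma dsum_coordP a x y i :
  dsum_coord i (a *: x + y) = a *: dsum_coord i x + dsum_coord i y.
Proof. by rewrite /dsum_coord linearP. Qed.

Lemma dsum_coord0 i : dsum_coord i 0 = 0.
Proof. by rewrite /dsum_coord linear0. Qed.

Lemma dsum_eq x y : (forall i, dsum_coord i x = dsum_coord i y) -> x = y.
Proof. by move=> H; apply: submod_incl_inj; apply: funext. Qed.

Lemma dsum_finite x : finite_set [set i | dsum_coord i x <> 0].
Proof. exact: (submod_inclP (P_closed := finite_support_closed) x). Qed.

Lemma dsum_make (f : I -> E) :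
  finite_support f -> exists x, forall i, dsum_coord i x = f i.
Proof.
move=> /(submod_inclS finite_support_closed) [x hx]; exists x => i.
by rewrite /dsum_coord /dsum_fun hx.
Qed.

End Def.

Section Map.
Variables (E F : lmodType L) (f : {linear E -> F}).

Lemma dsum_map_exists : exists g : {linear dsum E -> dsum F},
  forall x i, dsum_coord i (g x) = f (dsum_coord i x).
Proof.
have H x : exists y : dsum F, forall i, dsum_coord i y = f (dsum_coord i x).
  apply: dsum_make; apply: sub_finite_set (dsum_finite x) => i /= h e.
  by apply: h; rewrite e linear0.
case/choice: H => g hg.
have lin a x y : g (a *: x + y) = a *: g x + g y.
  by apply: dsum_eq => i; rewrite dsum_coordP !hg dsum_coordP linearP.
by exists (mklin lin).
Qed.

Definition dsum_map : {linear dsum E -> dsum F} := projT1 (cid dsum_map_exists).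

Lemma dsum_mapE x i : dsum_coord i (dsum_map x) = f (dsum_coord i x).
Proof. exact: (projT2 (cid dsum_map_exists)). Qed.

Lemma dsum_map_inj : injective f -> injective dsum_map.
Proof.
move=> fI x y e; apply: dsum_eq => i; apply: fI.
by rewrite -!dsum_mapE e.
Qed.

End Map.

Lemma dsum_exact (E F G : lmodType L) (f : {linear E -> F}) (g : {linear F -> G}) :
  exact_at f g -> exact_at (dsum_map f) (dsum_map g).
Proof.
move=> ex y; split=> [gy|[x <-]]; last first.
  by apply: dsum_eq => i; rewrite !dsum_mapE dsum_coord0; apply/ex; eexists.
have H i : exists x, f x = dsum_coord i y /\ (dsum_coord i y = 0 -> x = 0).
  have [->|ny] := EM (dsum_coord i y = 0); first by exists 0; rewrite linear0.
  have [|x hx] := (ex (dsum_coord i y)).1; first by rewrite -dsum_mapE gy dsum_coord0.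
  by exists x.
case/choice: H => x hx.
have [|z hz] := @dsum_make E x.
  apply: sub_finite_set (dsum_finite y) => i /= h e.
  by apply: h; case: (hx i) => _; apply.
by exists z; apply: dsum_eq => i; rewrite dsum_mapE hz; case: (hx i).
Qed.

(** The ideal [Q] has finitely many generators, whose images have finite support. Outside the union
    [S] of these supports every coordinate of [f] vanishes on [Q], so the coordinatewise solutions
    may be replaced by 0 there. *)
Lemma dsum_baer (E : lmodType L) :
  left_noetherian L -> injective_module E -> baer (dsum E).
Proof.
move=> acc /injective_baer bE Q f Qcl fQ.
have [n [r hr]] := noetherian_regular acc Qcl.
have Qr k : Q (r k) by apply/hr; exists (delta_mx 0 k); rewrite rowlin_delta.
have /choice [e he] : forall i, exists e : E,
    forall s : L, Q s -> dsum_coord i (f s) = s *: e.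
  move=> i; apply: (bE Q (fun s => dsum_coord i (f s))) => // a x y Qx Qy.
  by rewrite fQ // dsum_coordP.
pose S := (\bigcup_(k in [set: 'I_n]) [set i | dsum_coord i (f (r k)) <> 0])%classic.
have Sfin : finite_set S.
  by apply: bigcup_finite => // k _; apply: dsum_finite.
have [|z hz] := @dsum_make E (fun i => if `[< S i >] then e i else 0).
  by apply: sub_finite_set Sfin => i /=; case: asboolP.
exists z => s Qs; apply: dsum_eq => i.
have -> : dsum_coord i ((s : L) *: z) = (s : L) *: dsum_coord i z.
  by rewrite -[_ *: z]addr0 dsum_coordP dsum_coord0 addr0.
rewrite he // hz; case: asboolP => // nS.
have ri k : (r k : L) *: e i = 0.
  by rewrite -he //; apply: contrapT => h; apply: nS; exists k.
have /hr [v <-] := Qs; rewrite rowlinE scaler0.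
elim/big_ind: _ => [|x y hx hy|k _]; first by rewrite scale0r.
  by rewrite scalerDl hx hy addr0.
by rewrite -[_ *: r k]/(_ * _ : L) -scalerA ri scaler0.
Qed.

Lemma dsum_injective (E : lmodType L) :
  left_noetherian L -> injective_module E -> injective_module (dsum E).
Proof. by move=> acc hE; apply/baer_injective/dsum_baer. Qed.

End DirectSum.

Section FreeCover.
Variables (L : pzRingType) (P : lmodType L).

Definition dsum_eval (x : dsum P (L^o : lmodType L)) : P :=
  \sum_(i \in [set: P]) ((dsum_coord i x : L) *: i).

Lemma dsum_evalE (r : seq P) x : uniq r ->
  (forall i, dsum_coord i x <> 0 -> i \in r) ->
  dsum_eval x = \sum_(i <- r) ((dsum_coord i x : L) *: i).
Proof.
move=> ur hr; rewrite /dsum_eval (@fsbigE _ _ _ _ _ r) // => [|i _ nr].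
  by apply: eq_bigl => i; rewrite in_setT.
have -> : dsum_coord i x = 0; last exact: scale0r.
by apply: contrapT => /hr; rewrite (negbTE nr).
Qed.

Lemma dsum_support_seq (x : dsum P (L^o : lmodType L)) :
  exists r : seq P, forall i, dsum_coord i x <> 0 -> i \in r.
Proof.
have [r hr] := (finite_seqP _).1 (dsum_finite x).
exists r => i hi; have : [set` r]%classic i by rewrite -hr.
by [].
Qed.

Lemma dsum_eval_linear a x y :
  dsum_eval (a *: x + y) = a *: dsum_eval x + dsum_eval y.
Proof.
have [[r hr] [s hs]] := (dsum_support_seq x, dsum_support_seq y).
have ut := undup_uniq (r ++ s).
rewrite !(dsum_evalE ut) => [|i /hs|i /hr|i].
- rewrite scaler_sumr -big_split; apply: eq_bigr => i _.
  by rewrite dsum_coordP scalerDl scalerA.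
- by rewrite mem_undup mem_cat => ->; rewrite orbT.
- by rewrite mem_undup mem_cat => ->.
- move=> h; rewrite mem_undup mem_cat; apply/orP.
  have [xi|/hr] := EM (dsum_coord i x = 0); last by left.
  right; apply: hs => yi; apply: h.
  by rewrite dsum_coordP xi yi scaler0 addr0.
Qed.

Definition dsum_evalL : {linear dsum P (L^o : lmodType L) -> P} :=
  mklin dsum_eval_linear.

Lemma dsum_eval_surj p : exists x, dsum_evalL x = p.
Proof.
have [|x hx] := @dsum_make L P (L^o : lmodType L) (fun i => if i == p then 1 else 0).
  apply: sub_finite_set (finite_set1 p) => i /=.
  by case: eqP.
exists x; rewrite mklinE (@dsum_evalE [:: p]) //; last first.
  by move=> i; rewrite hx inE; case: eqP.
by rewrite big_seq1 hx eqxx scale1r.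
Qed.

End FreeCover.

(** * The bound of Fin.dim by the injective dimension *)

Section InjectiveBound.
Variable L : pzRingType.
Hypothesis acc : left_noetherian L.
Variables (X : nat -> lmodType L) (d : forall i, {linear X i -> X i.+1}).
Variable e : {linear (L^o : lmodType L) -> X 0}.
Hypothesis res : injective_resolution d e.

Let dI (I : choiceType) i : {linear dsum I (X i) -> dsum I (X i.+1)} :=
  dsum_map I (d i).

(** For k = 0 the module [K] is projective, hence a retract of a direct sum of copies of L.
    Vanishing of Ext^1 into that sum extends the embedding of [K] to [P], so [K] splits off [P] and
    [M] is the complement. Larger k shift down. *)
Lemma pd_le_drop k (M : lmodType L) :
  pd_le k.+1 M -> (forall I : choiceType, ext_vanish (dI I) k.+1 M) -> pd_le k M.
Proof.
case: res => Xinj eI ex0 exd.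
have dinj I i : injective_module (dsum I (X i)) by apply: dsum_injective.
have dex I i : exact_at (dI I i) (dI I i.+1) by apply: dsum_exact.
elim: k M => [|k IH] M [K [P [j [p [Pproj jI ex pS pdK]]]]] van.
  have [|s hs] := pdK _ _ (dsum_evalL K) idfun; first exact: dsum_eval_surj.
  have dex0 := @dsum_exact _ K _ _ _ _ _ ex0.
  have /(ext_vanish_quotient (dinj K) (dex K) Pproj jI ex pS) H := van K.
  have [|g dg gj] := H (dsum_map K e \o s).
    by move=> x; apply/dex0; exists (s x).
  have /choice [h hh] x : exists y, dsum_map K e y = g x.
    by apply/dex0/dg.
  have eKI := dsum_map_inj (I := K) eI.
  have hlin a x y : h (a *: x + y) = a *: h x + h y.
    by apply: eKI; rewrite linearP !hh linearP.
  have hj x : h (j x) = s x by apply: eKI; rewrite hh gj.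
  have qlin a x y : a *: x + y - j (dsum_evalL K (h (a *: x + y)))
      = a *: (x - j (dsum_evalL K (h x))) + (y - j (dsum_evalL K (h y))).
    by rewrite hlin !linearP scalerDr addrACA.
  have [|t ht] := factor_surj (p := p) (g := mklin qlin) pS.
    by move=> _ /ex [x <-]; rewrite mklinE hj hs /= subrr.
  apply: (@projective_retract _ _ _ p t) => // x.
  have [y <-] := pS x; rewrite ht mklinE linearB.
  suff -> : p (j (dsum_evalL K (h y))) = 0 by rewrite subr0.
  by apply/ex; eexists.
exists K, P, j, p; split=> //; apply: IH => // I.
exact/(ext_vanish_shift (dinj I) (dex I) Pproj jI ex pS)/van.
Qed.

Lemma pd_le_inj_dim n m (M : lmodType L) :
  vanishes_above X n -> pd_le m M -> pd_le n M.
Proof.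
move=> van; elim: m => [|m IH] pdM; first exact: pd_le_leq pdM.
have [mn|nm] := leqP m.+1 n; first exact: pd_le_leq pdM.
apply/IH/pd_le_drop => // I; apply: ext_vanish_zero => x.
by apply: dsum_eq => i; rewrite dsum_coord0; apply: van.
Qed.

End InjectiveBound.

(** * Tensor products, flatness and Tor in terms of matrices *)

Section MatrixAction.
Variables (L : pzRingType) (V : lmodType L).

(* Matrices act on tuples of module elements; this is A (x) V on L^n (x) V. *)
Definition mxact m n (A : 'M[L]_(m, n)) (x : 'I_n -> V) : 'I_m -> V :=
  fun i => \sum_j A i j *: x j.

Lemma mxact_mul m n p (A : 'M[L]_(m, n)) (B : 'M_(n, p)) x i :
  mxact (A *m B) x i = mxact A (mxact B x) i.
Proof.
rewrite /mxact; under eq_bigr do rewrite mxE scaler_suml.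
rewrite exchange_big; apply: eq_bigr => j _ /=.
by rewrite scaler_sumr; apply: eq_bigr => k _; rewrite scalerA.
Qed.

Lemma mxactB m n (A : 'M[L]_(m, n)) x y i :
  mxact A (fun j => x j - y j) i = mxact A x i - mxact A y i.
Proof.
rewrite /mxact -sumrB; apply: eq_bigr => j _.
by rewrite scalerBr.
Qed.

Lemma mxact0 m n (A : 'M[L]_(m, n)) x i :
  (forall j, x j = 0) -> mxact A x i = 0.
Proof. by move=> h; apply: big1 => j _; rewrite h scaler0. Qed.

Lemma eq_mxact m n (A : 'M[L]_(m, n)) x y i :
  x =1 y -> mxact A x i = mxact A y i.
Proof. by move=> h; apply: eq_bigr => j _; rewrite h. Qed.

End MatrixAction.

Lemma mxact_lin (L : pzRingType) (U V : lmodType L) (f : {linear U -> V}) m n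
    (A : 'M[L]_(m, n)) x i :
  f (mxact A x i) = mxact A (fun j => f (x j)) i.
Proof.
by rewrite /mxact linear_sum; apply: eq_bigr => j _; rewrite linearZ.
Qed.

(* The dual of row exactness: the right modules L^p -> L^n -> L^m. *)
Definition col_exact (L : pzRingType) m n p (B : 'M[L]_(m, n)) (C : 'M[L]_(n, p)) :=
  B *m C = 0 /\ forall v : 'cV_n, B *m v = 0 -> exists w, v = C *m w.

Section TensorElements.
Variables (L : pzRingType) (A : lmodType L^c) (M : lmodType L).

Definition tns (a : A) (m : M) : tensor A M := \pi_(tensor A M) << (a, m) >>.

Lemma tensor_piE (y z : {freeg (A * M) / int}) :
  \pi_(tensor A M) y = \pi_(tensor A M) z <-> tensor_rel (y - z).
Proof.
split=> [/eqP|h]; first by rewrite -Quotient.idealrBE => /asboolP.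
by apply/eqP; rewrite -Quotient.idealrBE; apply/asboolP.
Qed.

Lemma tensor_piD (y z : {freeg (A * M) / int}) :
  \pi_(tensor A M) (y + z) = \pi_(tensor A M) y + \pi_(tensor A M) z.
Proof. exact: (@Quotient.pi_add _ (@tensor_relb L A M)). Qed.

Lemma tensor_pi0 : \pi_(tensor A M) 0 = 0.
Proof.
by apply: (addrI (\pi_(tensor A M) 0)); rewrite -tensor_piD !addr0.
Qed.

Lemma tensor_pi_sum n (F : 'I_n -> {freeg (A * M) / int}) :
  \pi_(tensor A M) (\sum_i F i) = \sum_i \pi_(tensor A M) (F i).
Proof.
apply: (big_morph (fun x => \pi_(tensor A M) x)); first exact: tensor_piD.
exact: tensor_pi0.
Qed.

Lemma tnsDl a a' m : tns (a + a') m = tns a m + tns a' m.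
Proof.
rewrite /tns -tensor_piD; apply/tensor_piE.
by rewrite opprD addrA; apply: tensor_relDl.
Qed.

Lemma tnsDr a m m' : tns a (m + m') = tns a m + tns a m'.
Proof.
rewrite /tns -tensor_piD; apply/tensor_piE.
by rewrite opprD addrA; apply: tensor_relDr.
Qed.

Lemma tnsZ a (r : L) m : tns ((r : L^c) *: a) m = tns a (r *: m).
Proof. exact/tensor_piE/tensor_relZ. Qed.

Lemma tns0l m : tns 0 m = 0.
Proof. by apply: (addrI (tns 0 m)); rewrite -tnsDl !addr0. Qed.

Lemma tns0r a : tns a 0 = 0.
Proof. by apply: (addrI (tns a 0)); rewrite -tnsDr !addr0. Qed.

Lemma tns_suml n (F : 'I_n -> A) m : tns (\sum_i F i) m = \sum_i tns (F i) m.
Proof.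
by apply: (big_morph (tns^~ m)) => [a a'|]; [apply: tnsDl|apply: tns0l].
Qed.

Lemma tns_sumr n a (F : 'I_n -> M) : tns a (\sum_i F i) = \sum_i tns a (F i).
Proof.
by apply: (big_morph (tns a)) => [m m'|]; [apply: tnsDr|apply: tns0r].
Qed.

End TensorElements.

Section Flat.
Variables (L : pzRingType) (F : lmodType L).

(** Let [A] be the image of [B] on columns. The element of A (x) F given by [y] dies in L^m (x) F,
    hence is zero by flatness. As [A] is also the cokernel of [C], this places [y] in the image of
    [C]. *)
Lemma flat_equational m n p (B : 'M[L]_(m, n)) (C : 'M[L]_(n, p)) (y : 'I_n -> F) :
  flat_module F -> col_exact B C -> (forall i, mxact B y i = 0) ->
  exists f, y =1 mxact C f.
Proof.
move=> flat [_ ex] By.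
pose Bc := (B : 'M[L^c]_(m, n))^T.
have [A [q [i [qS iI iq]]]] := image_factorization (mxlin Bc).
pose z : {freeg (A * F) / int} := \sum_k << (q (delta_mx 0 k), y k) >>.
have pz : \pi_(tensor A F) z = \pi_(tensor A F) 0.
  apply: (flat _ _ i iI); rewrite !tensor_map_pi.
  have fgB := freeg_tensor_mapB (M := F) i.
  have fg0 : freeg_tensor_map i (0 : {freeg (A * F) / int}) = 0.
    by rewrite -(subrr 0) fgB subrr.
  have fgD : {morph freeg_tensor_map (M := F) i : u v / u + v}.
    move=> u v; rewrite -{1}[v]opprK fgB -[- v]sub0r fgB fg0 sub0r.
    by rewrite opprK.
  have -> : freeg_tensor_map i z = \sum_k << (i (q (delta_mx 0 k)), y k) >>.
    rewrite /z (big_morph _ fgD fg0); apply: eq_bigr => k _.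
    by rewrite /freeg_tensor_map liftU scale1r.
  rewrite fg0 tensor_pi0 tensor_pi_sum.
  transitivity (\sum_k \sum_l tns (delta_mx 0 l : 'rV[L^c]_m) (B l k *: y k)).
    apply: eq_bigr => k _; rewrite -/(tns _ _) iq mxlinE -rowE.
    rewrite [row k Bc]row_sum_delta tns_suml; apply: eq_bigr => l _.
    by rewrite !mxE tnsZ.
  rewrite exchange_big big1 // => l _ /=.
  by rewrite -tns_sumr [X in tns _ X]By tns0r.
have [s hs] := surj_section qS.
pose W := zmodule ('I_n -> F).
(* The section [s] is only a map of sets, so [psi] respects the tensor relations only up to elements
   of ker q acting on F; these are [good] because ker q is the image of [C]. *)
pose psi (p : A * F) : W := fun k => (s p.1 0 k : L) *: p.2.
pose good (w : W) := exists f, w =1 mxact C f.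
have good0 : good 0.
  by exists (fun _ => 0) => k; rewrite mxact0.
have goodB w w' : good w -> good w' -> good (w - w').
  move=> [f hf] [f' hf']; exists (fun j => f j - f' j) => k.
  by rewrite mxactB -hf -hf'.
have goodE (v : 'rV[L^c]_n) x : q v = 0 -> good (fun k => (v 0 k : L) *: x).
  move=> qv; have [|w hw] := ex ((v : 'rV[L]_n)^T).
    apply/colP=> k; have := congr1 i qv; rewrite iq linear0 mxlinE => /rowP /(_ k).
    rewrite !mxE => {2}<-; apply: eq_bigr => l _; by rewrite !mxE.
  exists (fun j => w j 0 *: x) => k.
  have -> : (v 0 k : L) = (C *m w) k 0 by rewrite -hw mxE.
  rewrite mxE scaler_suml; apply: eq_bigr => j _.
  by rewrite scalerA.
have psiU a x : fglift psi << (a, x) >> = psi (a, x) by rewrite liftU scale1r.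
have goodR w : tensor_rel w -> good (fglift psi w).
  have lB : {morph fglift psi : u v / u - v} by exact: lift_is_additive.
  elim=> [|u v _ hu _ hv|a a' x|a x x'|a r x].
  - by rewrite -(subrr 0) lB subrr.
  - by rewrite lB; apply: goodB.
  - rewrite !lB !psiU.
    have -> : psi (a + a', x) - psi (a, x) - psi (a', x)
        = fun k => ((s (a + a') - s a - s a') 0 k : L) *: x.
      apply: funext => k; rewrite !mxE !scalerDl !scaleNr //.
    by apply: goodE; rewrite !linearB !hs addrAC addrK subrr.
  - rewrite !lB !psiU.
    have -> : psi (a, x + x') - psi (a, x) - psi (a, x') = 0; last exact: good0.
    apply: funext => k.
    by rewrite -[LHS]/(_ *: _ - _ *: _ - _ *: _) /= scalerDr addrAC addrK subrr.
  - rewrite lB !psiU.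
    have -> : psi ((r : L^c) *: a, x) - psi (a, r *: x)
        = fun k => ((s ((r : L^c) *: a) - (r : L^c) *: s a) 0 k : L) *: x.
      apply: funext => k; rewrite !mxE scalerDl scaleNr.
      by rewrite -[LHS]/(_ *: _ - _ *: _) /= scalerA.
    by apply: goodE; rewrite linearB linearZ /= !hs subrr.
have /tensor_piE := pz; rewrite subr0 => /goodR [f hf].
have goodD w w' : good w -> good w' -> good (w + w').
  move=> hw hw'; rewrite -[w']opprK -[- w']sub0r.
  exact: (goodB _ _ hw (goodB _ _ good0 hw')).
have [g hg] : good (\sum_l
    fun k => ((s (q (delta_mx 0 l)) - delta_mx 0 l) 0 k : L) *: y l).
  apply: (big_ind good) => // l _; apply: goodE.
  by rewrite linearB hs subrr.
have lB : {morph fglift psi : u v / u - v} by exact: lift_is_additive.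
have l0 : fglift psi 0 = 0 by rewrite -(subrr 0) lB subrr.
have lD : {morph fglift psi : u v / u + v}.
  move=> u v; rewrite -{1}[v]opprK lB -[- v]sub0r lB l0 sub0r.
  by rewrite opprK.
exists (fun j => f j - g j) => k.
rewrite mxactB -hf -hg /z (big_morph _ lD l0) !fct_sumE -sumrB.
transitivity (\sum_l ((delta_mx 0 l : 'rV[L]_n) 0 k *: y l)).
  rewrite (bigD1 k) //= big1 => [|l lk]; rewrite mxE !eqxx ?scale1r ?addr0 //=.
  by rewrite eq_sym (negbTE lk) scale0r.
apply: eq_bigr => l _; rewrite psiU /psi /= !mxE scalerBl.
by rewrite subKr.
Qed.
End Flat.

Section Tor.
Variable L : pzRingType.
Variables (b : nat -> nat) (B : forall k, 'M[L]_(b k, b k.+1)).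
Hypothesis B_exact : forall k, col_exact (B k) (B k.+1).

(** This is Tor_(k+1)(X, M) = 0 for the right module X presented by [B 0] and fd M <= n <= k, by
    shifting along a flat resolution of [M] down to [flat_equational]. *)
Lemma tor_vanish n k (M : lmodType L) X d e (y : 'I_(b k.+1) -> M) :
  @left_resolution L (@flat_module L) M X d e -> vanishes_above X n ->
  (n <= k)%N -> (forall i, mxact (B k) y i = 0) ->
  exists f, y =1 mxact (B k.+1) f.
Proof.
elim: n k M X d e y => [|n IH] k M X d e y res van nk By.
  case: res => Xflat eS ex0 exd.
  have /choice [y0 hy0] i := eS (y i).
  have [|f hf] := flat_equational (y := y0) (Xflat 0) (B_exact k).
    move=> i; have /ex0 [x <-] : e (mxact (B k) y0 i) = 0.
      by rewrite mxact_lin -[RHS](By i); apply: eq_mxact.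
    by rewrite (van 1%N isT x) linear0.
  by exists (fun j => e (f j)) => i; rewrite -hy0 hf mxact_lin.
case: k y nk By => [//|k] y nk By.
have [e' he' res'] := left_resolution_tail res.
case: res => Xflat eS ex0 exd.
have /choice [y0 hy0] i := eS (y i).
have /choice [z hz] i : exists z, ker_incl e z = mxact (B k.+1) y0 i.
  apply: ker_inclS; rewrite mxact_lin -[RHS](By i).
  exact: eq_mxact.
have [||g hg] := IH k _ _ _ _ z res' _ nk.
- by move=> i hi; apply: van.
- move=> i; apply: (@ker_incl_inj _ _ _ e).
  rewrite mxact_lin (eq_mxact _ _ hz) -mxact_mul (proj1 (B_exact k)) linear0.
  by apply: big1 => j _; rewrite mxE scale0r.
have [|f hf] := flat_equational (y := fun j => y0 j - ker_incl e (g j))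
    (Xflat 0) (B_exact k.+1).
  by move=> i; rewrite mxactB -hz hg mxact_lin subrr.
exists (fun j => e (f j)) => i.
by rewrite -mxact_lin -hf linearB ker_inclK subr0 hy0.
Qed.

End Tor.

(** * Free resolutions given by sequences of matrices *)

Section Resolutions.
Variable L : pzRingType.

Definition row_exact m n p (A : 'M[L]_(m, n)) (B : 'M[L]_(n, p)) :=
  A *m B = 0 /\ forall v : 'rV_n, v *m B = 0 -> exists w, v = w *m A.

(** Makes the first sizes of a resolution reduce to prescribed ones by computation, so that given
    matrices fit in without casts. *)
Definition scons (n : nat) (q : nat -> nat) (k : nat) : nat :=
  if k is k'.+1 then q k' else n.

Hypothesis acc : left_noetherian L.

Lemma row_kernel n p (B : 'M[L]_(n, p)) :
  exists mA : {m & 'M[L]_(m, n)}, row_exact (projT2 mA) B.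
Proof.
have [|m [A hA]] := @noetherian_row_mx L n (fun v => v *m B = 0) acc.
  split; first exact: mul0mx.
  by move=> a x y hx hy; rewrite mulmxDl -scalemxAl hx hy scaler0 addr0.
exists (existT _ m A); split=> /=.
  apply/row_matrixP => i; rewrite row_mul row0; apply/hA.
  by exists (delta_mx 0 i); rewrite -rowE.
by move=> v /hA [w <-]; exists w.
Qed.

Lemma row_resolution m n (D0 : 'M[L]_(m, n)) :
  exists (q : nat -> nat),
  let z := scons n (scons m q) in
  exists D : forall k, 'M[L]_(z k.+1, z k),
    D 0 = D0 /\ forall k, row_exact (D k.+1) (D k).
Proof.
pose T := {a : nat & {c : nat & 'M[L]_(c, a)}}.
have K (x : T) := cid (row_kernel (projT2 (projT2 x))).
pose next (x : T) : T := existT _ (projT1 (projT2 x)) (sval (K x)).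
pose s k : T := iter k next (existT _ n (existT _ m D0)).
exists (fun k => projT1 (s k.+2)) => z.
pose D k : 'M[L]_(z k.+1, z k) :=
  match k return 'M[L]_(z k.+1, z k) with
  | 0 => D0
  | 1 => projT2 (projT2 (s 1))
  | k.+2 => projT2 (projT2 (s k.+2))
  end.
exists D; split=> // -[|[|k]].
- exact: (svalP (K (s 0))).
- exact: (svalP (K (s 1))).
- exact: (svalP (K (s k.+2))).
Qed.

Lemma free_resolution (M : lmodType L) (z : nat -> nat)
    (D : forall k, 'M[L]_(z k.+1, z k)) (e : {linear 'rV[L]_(z 0) -> M}) :
  (forall x, exists y, e y = x) ->
  (forall y, e y = 0 <-> exists v, y = v *m D 0) ->
  (forall k, row_exact (D k.+1) (D k)) ->
  left_resolution (@projective_module L) (X := fun k => 'rV[L]_(z k))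
    (fun k => mxlin (D k)) e.
Proof.
move=> eS e0 De; split=> //.
- by move=> i; apply: projective_row.
- by move=> y; rewrite e0; split=> [[v ->]|[v <-]]; exists v.
- move=> i y; rewrite mxlinE; split=> [|[w <-]]; last first.
    by rewrite mxlinE -mulmxA (De i).1 mulmx0.
  by move/((De i).2 y) => [w ->]; exists w.
Qed.

End Resolutions.

(** * Null-homotopies between row and column complexes *)

Section Zigzag.
Variable L : pzRingType.

Section Images.
Variable z : nat -> nat.
Variable G : forall k, 'M[L]_(z k, z k.+1).
Variable D : forall k, 'M[L]_(z k.+1, z k).

(** In degree 0 the incoming map is zero, so exactness there means injectivity; the same convention
    holds for [colim]. *)
Definition rowim j p : 'M[L]_(p, z j) -> Prop :=
  match j with
  | 0 => fun f => f = 0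
  | j.+1 => fun f => exists f', f = f' *m G j
  end.

Definition colim s p : 'M[L]_(z s, p) -> Prop :=
  match s with
  | 0 => fun f => f = 0
  | s.+1 => fun f => exists f', f = D s *m f'
  end.

Definition rows_exact_at j :=
  forall p (f : 'M[L]_(p, z j)), f *m G j = 0 -> rowim f.

Definition cols_exact_at s :=
  forall p (f : 'M[L]_(z s, p)), D s *m f = 0 -> colim f.

Lemma colim_col s :
  (forall v : 'cV_(z s), D s *m v = 0 -> colim v) -> cols_exact_at s.
Proof.
case: s => [|s] H p f Df /=.
  have f0 i : col i f = 0 by apply: H; rewrite colE mulmxA Df mul0mx.
  by apply/matrixP => i j; have /colP /(_ i) := f0 j; rewrite !mxE.
by apply: mulmx_colwise => i; apply: H; rewrite colE mulmxA Df mul0mx.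
Qed.

Lemma rowim_row j :
  (forall v : 'rV_(z j), v *m G j = 0 -> rowim v) -> rows_exact_at j.
Proof.
case: j => [|j] H p f Gf /=.
  have f0 i : row i f = 0 by apply: H; rewrite -row_mul Gf row0.
  by apply/row_matrixP => i; rewrite f0 row0.
by apply: mulmx_rowwise => i; apply: H; rewrite -row_mul Gf row0.
Qed.

End Images.

Variables (g q : nat -> nat).
Variable G : forall k, 'M[L]_(g k, g k.+1).
Variable D : forall k, 'M[L]_(q k.+1, q k).
Hypothesis GG : forall k, G k *m G k.+1 = 0.
Hypothesis DD : forall k, D k.+1 *m D k = 0.

(* A null-homotopy, built by chasing f through the chain map it induces.     *)
Lemma zigzag j s (f : 'M[L]_(q s, g j)) :
  (forall i, (i < j)%N -> rows_exact_at G i) ->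
  (forall i, (s <= i <= s + j)%N -> cols_exact_at D i) ->
  rowim G (D s *m f) ->
  exists f1 f2, [/\ f = f1 + f2, rowim G f1 & colim D f2].
Proof.
elim: j s f => [|j IH] s f rG cD.
  move=> Df; exists 0, f; split=> //; first by rewrite add0r.
  by apply: cD Df; rewrite leqnn leq_addr.
move=> [f' hf'].
have [|||f1 [f2 [ef' hf1 [h hf2]]]] := IH s.+1 f'.
- by move=> i hi; apply: rG; apply: ltnW.
- by move=> i /andP[hi hi']; apply: cD; rewrite (ltnW hi) /= addnS -addSn.
- by apply: rG => //; rewrite -mulmxA -hf' mulmxA DD mul0mx.
have f10 : f1 *m G j = 0.
  case: (j) f1 hf1 {ef'} => [|j'] f1 /=; first by move->; rewrite mul0mx.
  by case=> w ->; rewrite -mulmxA GG mulmx0.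
(* [h] is the next component of the homotopy: [D s] kills the remainder, since [f'] and [D s *m h]
   differ by [f1], which [G j] kills. *)
exists (h *m G j), (f - h *m G j); split; first by rewrite addrC subrK.
  by exists h.
apply: cD; first by rewrite leqnn leq_addr.
by rewrite mulmxBr hf' ef' mulmxDl f10 add0r hf2 mulmxA subrr.
Qed.

End Zigzag.

(** * Ext of cyclic submodules of Ext^(j+1)(X, L) *)

Section Grade.
Variable L : pzRingType.
Variables (E : nat -> lmodType L) (d : forall i, {linear E i -> E i.+1}).
Variable e : {linear (L^o : lmodType L) -> E 0}.
Hypothesis res : injective_resolution d e.

Lemma entry_linear n (v : 'cV[L]_n) a (x y : 'rV[L]_n) :
  ((a *: x + y) *m v) 0 0 = a *: ((x *m v) 0 0 : L^o) + (y *m v) 0 0.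
Proof. by rewrite mulmxDl -scalemxAl !mxE. Qed.

Definition colmap n (v : 'cV[L]_n) : {linear 'rV[L]_n -> L^o} :=
  mklin (V := L^o) (entry_linear v).

Lemma colmapE n (v : 'cV[L]_n) u : colmap v u = (u *m v) 0 0. Proof. by []. Qed.

Lemma colmap_eq0 n (v : 'cV[L]_n) : (forall u, colmap v u = 0) -> v = 0.
Proof.
move=> h; apply/colP => i; rewrite !mxE -[RHS](h (delta_mx 0 i)) colmapE.
by rewrite -rowE mxE.
Qed.

Lemma colmap_eq n (v w : 'cV[L]_n) : (forall u, colmap v u = colmap w u) -> v = w.
Proof.
move=> h; apply/eqP; rewrite -subr_eq0; apply/eqP/colmap_eq0 => u.
rewrite colmapE mulmxBr !mxE.
by have := h u; rewrite !colmapE !mxE => ->; rewrite subrr.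
Qed.

Lemma colmap_lift n (f : {linear 'rV[L]_n -> E 0}) :
  (forall x, d 0 (f x) = 0) -> exists v, forall u, f u = e (colmap v u).
Proof.
case: res => _ _ ex0 _ df.
have /choice [r hr] i : exists r, e r = f (delta_mx 0 i) by apply/ex0.
exists (\col_i r i) => u.
rewrite lin_rowE colmapE mxE linear_sum; apply: eq_bigr => i _.
by rewrite -hr mxE -linearZ.
Qed.

(** Maps from a free module of rows to [L] are columns, so dualizing the resolution means letting
    the same matrices act on columns. *)
Lemma ext_vanish_col_exact (z : nat -> nat)
    (D : forall k, 'M[L]_(z k.+1, z k)) (M : lmodType L)
    (p : {linear 'rV[L]_(z 0) -> M}) k :
  left_resolution (@projective_module L) (X := fun k => 'rV[L]_(z k))
    (fun k => mxlin (D k)) p ->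
  ext_vanish d k.+1 M <->
  forall v : 'cV_(z k.+1), D k.+1 *m v = 0 -> exists w, v = D k *m w.
Proof.
move=> pres; case: (res) => Einj eI ex0 exd.
have de r : d 0 (e r) = 0 by apply/ex0; exists r.
rewrite (ext_vanish_resolution Einj exd k pres); split=> H.
  move=> v Dv; have [||g dg hg] := H (e \o colmap v).
  - by move=> x /=; rewrite de.
  - move=> x; rewrite /= colmapE mxlinE -mulmxA Dv mulmx0 mxE.
    exact: linear0.
  have [w hw] := colmap_lift dg; exists w; apply: colmap_eq => u.
  apply: eI; rewrite -[LHS]/((e \o colmap v) u) -hg hw.
  by rewrite !colmapE mxlinE mulmxA.
move=> f df fD; have [v hv] := colmap_lift df.
have [|w hw] := H v.
  apply: colmap_eq0 => u; apply: eI.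
  by rewrite linear0 -[RHS](fD u) hv !colmapE mxlinE mulmxA.
exists (e \o colmap w) => x /=; first by rewrite de.
by rewrite hv hw !colmapE mxlinE mulmxA.
Qed.

Lemma ext_vanish0_col_inj n m (D : 'M[L]_(m, n)) (v : 'cV_n) :
  ext_vanish d 0 (coker (mxlin D)) -> D *m v = 0 -> v = 0.
Proof.
case: (res) => Einj eI ex0 exd H Dv.
have [|h hh] := factor_surj (p := coker_proj (mxlin D)) (g := e \o colmap v)
    (@coker_projS _ _ _ _).
  move=> u /coker_proj0 [w <-] /=.
  by rewrite colmapE mxlinE -mulmxA Dv mulmx0 mxE linear0.
apply: colmap_eq0 => u; apply: eI; rewrite linear0.
rewrite -[LHS]/((e \o colmap v) u) -hh; apply: H => x.
have [y <-] := coker_projS x; rewrite hh /=.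
by apply/ex0; eexists.
Qed.

Hypothesis flat_bound : forall i, dim_le (flat_dim (E i)) i.

Variables (b : nat -> nat) (B : forall k, 'M[L]_(b k, b k.+1)).
Hypothesis B_exact : forall k, col_exact (B k) (B k.+1).

(* A cyclic submodule L a of Ext^(j+1)(X, L), X the right module presented   *)
(* by B 0, has no nonzero map to E k for k <= j: extend such a map from L a  *)
(* to the whole cokernel of B j and use Tor_(j+1)(X, E k) = 0.               *)
Lemma ext_sub_hom_vanish j k (a : 'rV[L]_(b j.+1)) (c : E k) :
  (k <= j)%N -> a *m B j.+1 = 0 ->
  (forall (w : L) v, w *: a = v *m B j -> w *: c = 0) -> c = 0.
Proof.
move=> kj aB H; case: res => Einj _ _ _.
(* Extending along (w, v) |-> w a - v B_j prescribes in one stroke that [h] sends [a] to [c] and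
   kills the image of [B j]. *)
pose U : lmodType L := ((L^o : lmodType L) * 'rV[L]_(b j))%type.
have flin s (x y : U) : ((s *: x + y).1 : L) *: a - (s *: x + y).2 *m B j
    = s *: ((x.1 : L) *: a - x.2 *m B j) + ((y.1 : L) *: a - y.2 *m B j).
  rewrite -[(s *: x + y).1]/(s * x.1 + y.1) -[(s *: x + y).2]/(s *: x.2 + y.2).
  rewrite mulmxDl -scalemxAl scalerDl -scalerA scalerBr opprD.
  by rewrite addrACA.
have glin s (x y : U) : ((s *: x + y).1 : L) *: c
    = s *: ((x.1 : L) *: c) + (y.1 : L) *: c.
  by rewrite -[(s *: x + y).1]/(s * x.1 + y.1) scalerDl scalerA.
have [|h hh] := injective_extend (f := mklin flin) (g := mklin glin) (Einj k).
  move=> u; rewrite mklinE => /eqP; rewrite subr_eq0 => /eqP /H.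
  by [].
pose y i := h (delta_mx 0 i).
have hE v : h v = \sum_i v 0 i *: y i by apply: lin_rowE.
have [m mk [X [dX [p [pres van]]]]] := (dim_le_least _ _).1 (flat_bound k).
have [|f hf] := tor_vanish B_exact (y := y) pres van (leq_trans mk kj).
  move=> i; have := hh (0, - delta_mx 0 i); rewrite !mklinE /= !scale0r.
  rewrite mulNmx opprK add0r -rowE hE => h0; rewrite -[RHS]h0.
  by apply: eq_bigr => l _; rewrite mxE.
have := hh (1, 0); rewrite !mklinE /= !scale1r mul0mx subr0 => <-.
rewrite hE -[LHS]/(\sum_i a 0 i *: y i).
transitivity (mxact (a *m B j.+1) f 0).
  by rewrite mxact_mul; apply: eq_bigr => i _; rewrite hf.
by rewrite aB; apply: big1 => i _; rewrite mxE scale0r.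
Qed.

(** [D] resolves the cyclic module generated by the class of [a]. Every Hom from it to [E i] with i
    <= j is zero, so Ext^i into L vanishes for want of cochains; this is then read on the dual of
    [D]. *)
Lemma ext_sub_grade j (a : 'rV[L]_(b j.+1)) q
    (D : forall k, 'M[L]_(scons 1 q k.+1, scons 1 q k)) :
  a *m B j.+1 = 0 ->
  (forall w : 'rV_1,
     (exists v, w *m a = v *m B j) <-> exists v, w = v *m D 0) ->
  (forall k, row_exact (D k.+1) (D k)) ->
  forall k, (k <= j)%N -> forall v : 'cV_(scons 1 q k),
    D k *m v = 0 -> colim (z := scons 1 q) D v.
Proof.
move=> aB D0 Dex k kj.
have van i : (i <= j)%N -> ext_vanish d i (coker (mxlin (D 0))).
  move=> ij; have hom0 (f : {linear coker (mxlin (D 0)) -> E i}) x : f x = 0.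
    have [y <-] := coker_projS x.
    suff c0 : f (coker_proj (mxlin (D 0)) 1%:M) = 0.
      have -> : y = y 0 0 *: (1%:M : 'rV_1).
        by apply/rowP=> l; rewrite !mxE ord1 eqxx mulr1.
      by rewrite !linearZ /= c0 scaler0.
    apply: (ext_sub_hom_vanish ij aB) => w v wv.
    rewrite -!linearZ /=.
    suff -> : coker_proj (mxlin (D 0)) (w *: 1%:M) = 0 by rewrite linear0.
    have [|u hu] := (D0 (w *: 1%:M)).1.
      by exists v; rewrite -wv -scalemxAl mul1mx.
    by apply/coker_proj0; exists u; rewrite mxlinE.
  case: i ij hom0 => [|i] ij hom0 f _; first exact: hom0.
  by exists (zero_map _ _) => x; rewrite linear0 hom0.
case: k kj => [|k] kj v Dv; first exact: (ext_vanish0_col_inj (van 0 kj) Dv).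
apply: (ext_vanish_col_exact _ _).1 (van _ kj) _ Dv.
apply: (free_resolution (z := scons 1 q)) Dex.
  exact: coker_projS.
move=> y; rewrite coker_proj0; split=> [[u <-]|[u ->]]; exists u; exact: mxlinE.
Qed.
End Grade.

(** * The mapping cone and the vanishing of Ext^i(Ext^(t+1)(M, L), L) for i <= t *)

Section Cone.
Variable L : pzRingType.
Hypothesis acc : left_noetherian L.
Variables (E : nat -> lmodType L) (d : forall i, {linear E i -> E i.+1}).
Variable e : {linear (L^o : lmodType L) -> E 0}.
Hypothesis res : injective_resolution d e.
Hypothesis flat_bound : forall i, dim_le (flat_dim (E i)) i.

Variable z : nat -> nat -> nat.
Variable S : forall t k, 'M[L]_(z t k, z t k.+1).
Variable J : forall t k, 'M[L]_(z t.+1 k.+1, z t k).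
Hypothesis S_exact : forall t k, col_exact (S t k) (S t k.+1).
Hypothesis SJ : forall t k, S t.+1 k.+1 *m J t k.+1 = J t k *m S t k.
Hypothesis J0_inj : forall t p (x : 'M_(p, z t.+1 1)), x *m J t 0 = 0 -> x = 0.
Hypothesis S0_exact : forall t p (y : 'M_(p, z t 0)), y *m S t 0 = 0 ->
  exists v, y = v *m S t.+1 0 *m J t 0.

Let eq_row_mx0 m n p (A : 'M[L]_(m, n)) (B : 'M_(m, p)) :
  row_mx A B = 0 -> A = 0 /\ B = 0.
Proof. by rewrite -row_mx0 => /eq_row_mx. Qed.

Let SS t k : S t k *m S t k.+1 = 0. Proof. by case: (S_exact t k). Qed.

(* In the application z t 0 = z t.+1 1 and J t 0 = 1%:M, so degree 0 cancels  *)
(* against a summand of degree 1; the homology in degree k.+1 of the dual row *)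
(* complex is Ext^k(Ext^(t+1)(M, L), L).                                      *)
Definition cone_dim t k : nat :=
  match k with 0 => z t.+1 1 | k.+1 => z t.+1 k.+2 + z t k end.

Definition cone t k : 'M[L]_(cone_dim t k, cone_dim t k.+1) :=
  match k return 'M[L]_(cone_dim t k, cone_dim t k.+1) with
  | 0 => row_mx (S t.+1 1) (J t 0)
  | k.+1 => block_mx (S t.+1 k.+2) (J t k.+1) 0 (- S t k)
  end.

Lemma cone_mul0 t k : cone t k *m cone t k.+1 = 0.
Proof.
case: k => [|k] /=.
  by rewrite mul_row_block SS mulmx0 add0r mulmxN SJ subrr row_mx0.
rewrite mulmx_block SS !(mul0mx, mulmx0) !add0r mulmxN SJ subrr.
by rewrite mulmxN mulNmx opprK SS block_mx0.
Qed.

(* Ext^(k+1)(C, L) = 0 for the right module C presented by S t 0. *)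
Definition row_exact_at t k :=
  forall p (x : 'M_(p, z t k.+1)), x *m S t k.+1 = 0 -> exists y, x = y *m S t k.

(** [J t 0] carries [x] to a cycle of the original resolution of M, which is exact. *)
Lemma row_exact_at0 t : row_exact_at t.+1 0.
Proof.
move=> p x xS; have [|v hv] := @S0_exact t _ (x *m J t 0).
  by rewrite -mulmxA -SJ mulmxA xS mul0mx.
exists v; apply/eqP; rewrite -subr_eq0; apply/eqP/J0_inj.
by rewrite mulmxBl hv subrr.
Qed.

(** Let [S t] resolve C_(t+1). In the long exact sequence of 0 -> Ext^(t+1)(M, L) -> C_(t+1) ->
    Omega C_(t+2) -> 0, the group Ext^(k+2)(C_(t+2), L) lies between Ext^k(Ext^(t+1)(M, L), L) and
    Ext^(k+1)(C_(t+1), L). *)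
Lemma row_exact_atS t k :
  rows_exact_at (cone t) k.+1 -> row_exact_at t k -> row_exact_at t.+1 k.+1.
Proof.
move=> ex IH p x xS; have [|x' hx'] := IH _ (x *m J t k.+1).
  by rewrite -mulmxA -SJ mulmxA xS mul0mx.
have [|u /=] := ex _ (row_mx x x').
  by rewrite /= mul_row_block xS mulmx0 add0r mulmxN hx' subrr row_mx0.
case: k {ex IH} x xS x' hx' u => [|k] x xS x' hx' u /=.
  by rewrite mul_mx_row => /eq_row_mx [-> _]; exists u.
rewrite -[u]hsubmxK mul_row_block mulmx0 addr0 => /eq_row_mx [-> _].
by eexists.
Qed.

(** Injectivity of Ext^j(Ext^(t+1)(M, L), L) -> Ext^(j+2)(C_(t+2), L), which on cocycles keeps the
    first block. It follows from Ext^j(C_(t+1), L) = 0 for j > 0; for j = 0, [S0_exact] says that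
    every functional on C_(t+1) comes from Omega C_(t+2). *)
Lemma cone_row_inj t j p (a : 'M_(p, z t.+1 j.+2)) (b : 'M_(p, z t j)) a' :
  (forall k, j = k.+1 -> row_exact_at t k) ->
  row_mx a b *m cone t j.+1 = 0 -> a = a' *m S t.+1 j.+1 ->
  rowim (cone t) (row_mx a b : 'M_(p, cone_dim t j.+1)).
Proof.
move=> ex; rewrite /= mul_row_block mulmx0 addr0 mulmxN => /eq_row_mx0 [_ ab] ea.
pose b1 := b - a' *m J t j.
have b1S : b1 *m S t j = 0.
  rewrite mulmxBl -mulmxA -SJ mulmxA -ea -opprB.
  by rewrite ab oppr0.
have eb : b = a' *m J t j + b1 by rewrite addrC subrK.
case: j a b a' ex ab ea b1 b1S eb => [|j] a b a' ex ab ea b1 b1S eb.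
  have [v hv] := S0_exact b1S; exists (a' + v *m S t.+1 0) => /=.
  rewrite mul_mx_row !mulmxDl -hv -ea -[_ *m S _ 0 *m _]mulmxA SS mulmx0 addr0.
  by rewrite -eb.
have [y hy] := ex j erefl _ _ b1S.
exists (row_mx a' (- y)) => /=.
by rewrite mul_row_block mulmx0 addr0 -ea mulmxN mulNmx opprK -hy -eb.
Qed.

(** A cocycle [u] generates a cyclic module which [cone_row_inj] embeds in Ext^(j+2)(C_(t+2), L), so
    [ext_sub_grade] applies to its resolution [D]. Then [zigzag] from degree 0 of [D] makes [u] a
    coboundary, as nothing enters [D] in that degree. *)
Lemma cone_row_exact t j :
  (forall k, j = k.+1 -> row_exact_at t k) ->
  (forall i, (i <= j)%N -> rows_exact_at (cone t) i) ->
  rows_exact_at (cone t) j.+1.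
Proof.
move=> exS exC; apply: rowim_row => u uG.
pose a : 'rV_(z t.+1 j.+2) := lsubmx (u : 'rV_(z t.+1 j.+2 + z t j)).
pose b : 'rV_(z t j) := rsubmx (u : 'rV_(z t.+1 j.+2 + z t j)).
have uab : u = row_mx a b by rewrite hsubmxK.
have aS : a *m S t.+1 j.+2 = 0.
  by move: uG; rewrite uab /= mul_row_block mulmx0 addr0 => /eq_row_mx0 [].
have [|m [D0 hD0]] := @noetherian_row_mx L 1
    (fun w => exists v, w *m a = v *m S t.+1 j.+1) acc.
  split; first by exists 0; rewrite !mul0mx.
  move=> r x y [v hv] [v' hv']; exists (r *: v + v').
  by rewrite !mulmxDl -!scalemxAl hv hv'.
have [q [D [eD0 Dex]]] := row_resolution acc D0.
have grade i : (i <= j.+1)%N -> cols_exact_at D i.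
  move=> ij; apply: colim_col => v.
  apply: (ext_sub_grade res flat_bound (S_exact t.+1) aS _ Dex ij).
  move=> w; rewrite eD0 hD0; by split=> -[v' hv']; exists v'.
have [a' ha'] : exists a', D0 *m a = a' *m S t.+1 j.+1.
  apply: mulmx_rowwise => i; rewrite row_mul.
  by apply/hD0; exists (delta_mx 0 i); rewrite -rowE.
have [|||f1 [f2 [eu hf1 f20]]] :=
  @zigzag L (cone_dim t) _ (cone t) D (@cone_mul0 t) (fun k => (Dex k).1) j.+1 0 u.
- by move=> i; rewrite ltnS; apply: exC.
- by move=> i; rewrite add0n => /grade.
- rewrite eD0 uab mul_mx_row; apply: cone_row_inj ha' => //.
  by rewrite -mul_mx_row -uab -mulmxA uG mulmx0.
by rewrite eu f20 addr0.
Qed.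

Lemma cone_row_exact0 t : rows_exact_at (cone t) 0.
Proof.
by move=> p f /=; rewrite mul_mx_row => /eq_row_mx0 [_ /J0_inj].
Qed.

(** Exactness of the cones and of the duals of the [S t] feed each other, so both are proved
    together by induction on the degree, for all t at once. *)
Lemma cone_rows_exact t j : (j <= t.+1)%N -> rows_exact_at (cone t) j.
Proof.
suff H N : forall t,
    (forall j, (j <= N)%N -> (j <= t.+1)%N -> rows_exact_at (cone t) j) /\
    forall k, (k <= N)%N -> (k < t)%N -> row_exact_at t k.
  by move=> jt; apply: (H j t).1.
elim: N => [|N IH] {}t.
  split=> [i|k]; rewrite leqn0 => /eqP ->.
    by move=> _; apply: cone_row_exact0.
  by case: t => // t _; apply: row_exact_at0.
have exC t' j' : (j' <= N.+1)%N -> (j' <= t'.+1)%N -> rows_exact_at (cone t') j'.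
  rewrite leq_eqVlt => /predU1P [->|]; last by apply: (IH t').1.
  rewrite ltnS => Nt; apply: cone_row_exact => [k eN|i iN].
    by apply: (IH t').2; rewrite -?eN // eN.
  by apply: (IH t').1 => //; apply: leq_trans (leqW Nt).
split=> [i|k]; first exact: exC.
rewrite leq_eqVlt => /predU1P [->|]; last by apply: (IH t).2.
case: t => // t; rewrite ltnS => Nt.
apply: row_exact_atS; last exact: (IH t).2.
by apply: exC => //; apply: leqW.
Qed.

End Cone.

(** * Resolutions of right modules and lifting of chain maps *)

Section DualResolution.
Variable L : pzRingType.

Lemma col_resolution m n (A : 'M[L]_(m, n)) :
  left_noetherian L^c ->
  exists (q : nat -> nat),
  let z := scons m (scons n q) in
  exists S : forall k, 'M[L]_(z k, z k.+1),
    S 0 = A /\ forall k, col_exact (S k) (S k.+1).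
Proof.
move=> acc.
have [q [D [D0 Dex]]] := row_resolution acc (A : 'M[L^c]_(m, n))^T.
exists q => z; exists (fun k => (D k)^T : 'M[L]_(z k, z k.+1)).
split=> [|k]; first by rewrite D0 trmxK.
split.
  by apply: trmx_inj; rewrite trmx_mul_rev !trmxK (Dex k).1 trmx0.
move=> v Dv; have [|w hw] := (Dex k).2 (v : 'cV[L^c]_(z k.+1))^T.
  by rewrite -[X in _ *m X]trmxK -trmx_mul_rev Dv trmx0.
exists (w : 'rV[L]_(z k.+2))^T; apply: trmx_inj.
by rewrite hw trmx_mul_rev !trmxK.
Qed.

Lemma row_exact_mx m n p (A : 'M[L]_(m, n)) (B : 'M[L]_(n, p)) k (U : 'M_(k, n)) :
  row_exact A B -> U *m B = 0 -> exists W, U = W *m A.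
Proof.
move=> [_ ex] UB.
by apply: mulmx_rowwise => i; apply: ex; rewrite -row_mul UB row0.
Qed.

Lemma col_exact_mx m n p (B : 'M[L]_(m, n)) (C : 'M[L]_(n, p)) k (U : 'M_(n, k)) :
  col_exact B C -> B *m U = 0 -> exists W, U = C *m W.
Proof.
move=> [_ ex] BU.
by apply: mulmx_colwise => i; apply: ex; rewrite colE mulmxA BU mul0mx.
Qed.

Section Comparison.
Variables (z z' : nat -> nat).
Variables (S : forall k, 'M[L]_(z k, z k.+1)) (S' : forall k, 'M[L]_(z' k, z' k.+1)).
Hypothesis S_exact : forall k, col_exact (S k) (S k.+1).
Hypothesis S'0 : forall k, S' k *m S' k.+1 = 0.

Lemma comparison (J0 : 'M[L]_(z 1, z' 0)) : S 0 *m J0 *m S' 0 = 0 ->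
  exists J : forall k, 'M[L]_(z k.+1, z' k),
    J 0 = J0 /\ forall k, S k.+1 *m J k.+1 = J k *m S' k.
Proof.
move=> H0; pose T k := {X : 'M[L]_(z k.+1, z' k) | S k *m X *m S' k = 0}.
have next k (X : T k) : {Y : T k.+1 | S k.+1 *m sval Y = sval X *m S' k}.
  apply: cid; have [|Y hY] := col_exact_mx (U := sval X *m S' k) (S_exact k).
    by rewrite mulmxA (svalP X).
  have YP : S k.+1 *m Y *m S' k.+1 = 0 by rewrite -hY -mulmxA S'0 mulmx0.
  by exists (exist _ Y YP).
pose X := fix X k : T k := match k return T k with
  | 0 => exist _ J0 H0
  | k.+1 => sval (next k (X k))
  end.
exists (fun k => sval (X k)); split=> // k.
exact: (svalP (next k (X k))).
Qed.

End Comparison.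

End DualResolution.

(** * The finitely generated module resolved by the truncated dual cone *)

Section Cokernels.
Variable L : pzRingType.
Variables (g : nat -> nat) (G : forall k, 'M[L]_(g k, g k.+1)).
Hypothesis GG : forall k, G k *m G k.+1 = 0.

Definition syzygy k : lmodType L := coker (mxlin (G k)).

Lemma finitely_generated_syzygy k : finitely_generated (syzygy k).
Proof.
exists (g k.+1), (fun i => coker_proj (mxlin (G k)) (delta_mx 0 i)) => x.
have [y <-] := coker_projS x; exists (fun i => y 0 i).
exact: lin_rowE.
Qed.

Lemma syzygy_short_exact k : rows_exact_at G k.+1 ->
  exists j : {linear syzygy k -> 'rV[L]_(g k.+2)},
    [/\ forall v, j (coker_proj _ v) = v *m G k.+1, injective j
      & exact_at j (coker_proj (mxlin (G k.+1)))].
Proof.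
move=> ex.
have [|j hj] := factor_surj (p := coker_proj (mxlin (G k))) (g := mxlin (G k.+1))
    (@coker_projS _ _ _ _).
  by move=> u /coker_proj0 [w <-]; rewrite !mxlinE -mulmxA GG mulmx0.
exists j; split=> //.
  apply: injective_linear => x; have [y <-] := coker_projS x; rewrite hj.
  move=> /ex [w ->]; apply/coker_proj0.
  by exists w.
move=> y; rewrite coker_proj0; split=> [[u <-]|[x <-]].
  by exists (coker_proj _ u); rewrite hj.
by have [u <-] := coker_projS x; exists u; rewrite hj.
Qed.

Lemma pd_le_syzygy m k : (forall j, (j <= m)%N -> rows_exact_at G j) ->
  (k <= m)%N -> pd_le k.+1 (syzygy k).
Proof.
move=> ex; elim: k => [|k IH] km.
  exists 'rV[L]_(g 0), 'rV[L]_(g 1), (mxlin (G 0)), (coker_proj _); split.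
  - exact: projective_row.
  - by apply: injective_linear => x; apply: (ex 0).
  - by move=> y; rewrite coker_proj0.
  - exact: coker_projS.
  - exact: projective_row.
have [j [_ jI jex]] := syzygy_short_exact (ex _ km).
exists (syzygy k), 'rV[L]_(g k.+2), j, (coker_proj _); split=> //.
- exact: projective_row.
- exact: coker_projS.
- exact/IH/ltnW.
Qed.

Variables (E : nat -> lmodType L) (d : forall i, {linear E i -> E i.+1}).
Variable e : {linear (L^o : lmodType L) -> E 0}.
Hypothesis res : injective_resolution d e.

(** The complex up to [g m.+2] is a free resolution of [syzygy m.+1] in which [g 1] has homological
    degree m+1, so Ext^(m+1) is the homology of the dual at [g 1]. *)
Lemma ext_vanish_syzygy m (c : 'cV_(g 1)) :
  (forall j, (j <= m.+1)%N -> rows_exact_at G j) ->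
  ext_vanish d m.+1 (syzygy m.+1) -> G 0 *m c = 0 -> exists c', c = G 1 *m c'.
Proof.
case: (res) => Einj eI ex0 exd.
elim: m => [|m IH] ex van Gc; last first.
  apply: IH => //; first by move=> j hj; apply/ex/leqW.
  have [j [_ jI jex]] := syzygy_short_exact (ex _ (leqnn _)).
  have [h _] := ext_vanish_shift Einj exd (@projective_row L _) jI jex
    (@coker_projS _ _ _ _) m.
  exact: h.
have [j [jE jI jex]] := syzygy_short_exact (ex _ (leqnn _)).
have [h _] := ext_vanish_quotient Einj exd (@projective_row L _) jI jex
  (@coker_projS _ _ _ _) 0.
have [|f hf] := factor_surj (p := coker_proj (mxlin (G 0))) (g := e \o colmap c)
    (@coker_projS _ _ _ _).
  move=> u /coker_proj0 [w <-] /=.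
  by rewrite colmapE mxlinE -mulmxA Gc mulmx0 mxE linear0.
have [|k dk hk] := h van f.
  by move=> x; have [y <-] := coker_projS x; rewrite hf; apply/ex0; eexists.
have [w hw] := colmap_lift res dk; exists w; apply: colmap_eq => u.
apply: eI; rewrite -[LHS]/((e \o colmap c) u) -hf -hk hw jE.
by rewrite !colmapE mulmxA.
Qed.

End Cokernels.

(** * The bound of the injective dimension by fin.dim *)

Section Minimal.
Variable L : pzRingType.
Hypothesis accl : left_noetherian L.
Hypothesis accr : left_noetherian L^c.
Variables (E : nat -> lmodType L) (d : forall i, {linear E i -> E i.+1}).
Variable e : {linear (L^o : lmodType L) -> E 0}.
Hypothesis res : minimal_injective_resolution d e.
Hypothesis flat_bound : forall i, dim_le (flat_dim (E i)) i.

Lemma essential_neq0 i (x : E i) : x <> 0 -> exists2 y, y <> 0 & d i y = 0.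
Proof.
move=> x0; apply: contrapT => H; apply: x0.
apply: (res.2 i predT) => // y _ dy; apply: contrapT => y0.
by apply: H; exists y.
Qed.

(** If f = d g with f injective, the image of g meets ker d trivially; minimality makes that kernel
    essential, so g = 0 and f = 0. *)
Lemma ext_nonvanish m (M : lmodType L) (f : {linear M -> E m.+1}) :
  injective f -> (forall x, d m.+1 (f x) = 0) -> (exists x : M, x <> 0) ->
  ~ ext_vanish d m.+1 M.
Proof.
move=> fI df [x x0] /(_ f df) [g hg]; apply: x0.
have im0 y : g y = 0.
  apply: (res.2 m (im_pred g)); last by apply/im_predP; exists y.
    split; first by apply/im_predP; exists 0; rewrite linear0.
    move=> a _ _ /im_predP [u <-] /im_predP [v <-].
    by apply/im_predP; exists (a *: u + v); rewrite linearP.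
  move=> _ /im_predP [u <-]; rewrite hg => fu.
  by have -> : u = 0; [apply: fI; rewrite fu linear0|rewrite linear0].
by apply: fI; rewrite -hg im0 !linear0.
Qed.

Lemma vanishes_above_little n :
  (forall M : lmodType L,
     finitely_generated M -> proj_dim M <> None -> pd_le n M) ->
  vanishes_above E n.
Proof.
move=> bound [//|m] nm x; apply: contrapT => /essential_neq0 [x0 x0n dx0].
case: (res) => ires ess.
have [M [p [i [pS iI ip]]]] :=
  image_factorization (rowlin (fun _ : 'I_1 => x0)).
have [|m0 [D0 hD0]] := @noetherian_row_mx L 1 (fun v => p v = 0) accl.
  split; first exact: linear0.
  by move=> a u v hu hv; rewrite linearP hu hv scaler0 addr0.
have [q [A [A0 Aex]]] := row_resolution accl D0.
set nn := scons 1 (scons m0 q) in A A0 Aex.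
have p0 y : p y = 0 <-> exists v, y = v *m A 0.
  by rewrite A0 hD0; split=> -[v hv]; exists v.
have fres := free_resolution (z := nn) pS p0 Aex.
have [v Av nv] : exists2 v : 'cV_(nn m.+1), A m.+1 *m v = 0 &
    ~ exists w, v = A m *m w.
  apply: contrapT => H; refine (ext_nonvanish iI _ _ _).
  - move=> y; have [u <-] := pS y; rewrite ip rowlinE linear_sum big1 // => k _.
    by rewrite linearZ /= dx0 scaler0.
  - exists (p (delta_mx 0 0)) => h; apply: x0n.
    by rewrite -[LHS](rowlin_delta (fun _ : 'I_1 => x0) 0) -ip h linear0.
  - apply/(ext_vanish_col_exact ires m fres) => v Av.
    by apply: contrapT => nv; apply: H; exists v.
have R t := cid (col_resolution (A t) accr).
pose zz t := scons (nn t.+1) (scons (nn t) (sval (R t))).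
have R' t := cid (svalP (R t)).
pose S t : forall k, 'M[L]_(zz t k, zz t k.+1) := sval (R' t).
have S0 t : S t 0 = A t := (svalP (R' t)).1.
have Sex t k : col_exact (S t k) (S t k.+1) := (svalP (R' t)).2 k.
have C t : exists J : forall k, 'M[L]_(zz t.+1 k.+1, zz t k),
    J 0 = 1%:M /\ forall k, S t.+1 k.+1 *m J k.+1 = J k *m S t k.
  apply: (comparison (Sex t.+1) (fun k => (Sex t k).1)).
  by rewrite mulmx1 !S0 (Aex t).1.
have C' t := cid (C t).
pose J t : forall k, 'M[L]_(zz t.+1 k.+1, zz t k) := sval (C' t).
have J0 t : J t 0 = 1%:M := (svalP (C' t)).1.
have SJ t k : S t.+1 k.+1 *m J t k.+1 = J t k *m S t k := (svalP (C' t)).2 k.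
have rows j : (j <= m.+1)%N -> rows_exact_at (cone S J m) j.
  apply: (cone_rows_exact accl ires flat_bound Sex SJ) => t k y.
    by rewrite J0 mulmx1.
  by rewrite S0 => /(row_exact_mx (Aex t)) [w ->]; exists w; rewrite J0 mulmx1 S0.
have CC := cone_mul0 Sex SJ m.
(* Degree 0 of the cone is left uncancelled, hence the length m+2. This makes the projective
   dimension finite, so [bound] lowers it to n < m+1 and Ext^(m+1) must vanish. *)
have pdN : pd_le m.+2 (syzygy (cone S J m) m.+1) by apply: (pd_le_syzygy CC rows).
have pdn : pd_le n (syzygy (cone S J m) m.+1).
  apply: bound; first exact: finitely_generated_syzygy.
  by apply/proj_dim_finite; exists m.+2.
have van := pd_le_ext_vanish (d := d) (let: And4 h _ _ _ := ires in h)
  (let: And4 _ _ _ h := ires in h) pdn nm.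
have [y vy] := (Sex m.+1 0).2 v (etrans (congr1 (fun X => X *m v) (S0 m.+1)) Av).
(* This column is the cocycle of the cone that represents the class of [v]; the lower block of a
   primitive would write [v] as [A m] times a column. *)
have [|c'] := ext_vanish_syzygy (c := col_mx y (- v)) CC ires rows van.
  by rewrite /= mul_row_col J0 mul1mx -vy subrr.
rewrite -[c']vsubmxK /= mul_block_col => /eq_col_mx [_].
rewrite mul0mx add0r mulNmx => /oppr_inj; rewrite S0 => hv.
by apply: nv; eexists; apply: hv.
Qed.

End Minimal.

Theorem corollary2p17 (L : pzRingType)
    (hleft : left_noetherian L) (hright : left_noetherian L^c)
    (hgor : infinity_gorenstein L) :
  little_finitistic_dim L = big_finitistic_dim L /\
  big_finitistic_dim L = inj_dim (L^o : lmodType L).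
Proof.
have [X [d [e [res flat_bound]]]] := hgor.
have big_inj n : dim_le (inj_dim (L^o : lmodType L)) n ->
    dim_le (big_finitistic_dim L) n.
  move=> /dim_le_least [k kn [Y [dY [eY [resY van]]]]].
  apply/dim_le_sup => x [M [<- /proj_dim_finite [m pdM]]].
  apply: (dim_le_trans kn); apply/proj_dim_le.
  exact: (pd_le_inj_dim hleft resY van pdM).
have little_big n : dim_le (big_finitistic_dim L) n ->
    dim_le (little_finitistic_dim L) n.
  move=> /dim_le_sup H; apply/dim_le_sup => x [M [_ Mx xn]].
  by apply: H; exists M.
have inj_little n : dim_le (little_finitistic_dim L) n ->
    dim_le (inj_dim (L^o : lmodType L)) n.
  move=> /dim_le_sup H; apply/dim_le_least; exists n => //.
  exists X, d, e; split; first by case: res.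
  apply: (vanishes_above_little hleft hright res flat_bound) => M fgM fin.
  by apply/proj_dim_le/H; exists M.
split; apply: dim_le_eq => n; split.
- by move/inj_little/big_inj.
- exact: little_big.
- by move/little_big/inj_little.
- exact: big_inj.
Qed.
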